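(* Let $\beta=(\pi_\ell)_{\ell=1}^L$ be a non-redundant chainable architecture of depth $L\ge 2$, let $\mathbf{A}\in\mathbb{C}^{m\times n}$ with $m=a_1b_1d_1$, $n=a_Lc_Ld_L$, and let $\sigma$ be either the identity permutation $(1,\dots,L-1)$ or the permutation $(L-1,\dots,1)$. Then the butterfly algorithm with inputs $(\mathbf{A},\beta,\sigma)$ returns $(\mathbf{X}_\ell)_{\ell=1}^L\in\Sigma^\beta$ such that $$\|\mathbf{A}-\mathbf{X}_1\cdots\mathbf{X}_L\|_F^2\le\sum_{k=1}^{L-1}\big[E^{\beta_k}(\mathbf{A})\big]^2.$$
   Context: A pattern is a tuple $\pi=(a,b,c,d)$ of positive integers; $\mathbf{S}_\pi:=\mathbf{I}_a\otimes\mathbf{1}_{b\times c}\otimes\mathbf{I}_d\in\{0,1\}^{abd\times acd}$. A $\pi$-factor is a complex $abd\times acd$ matrix with support contained in that of $\mathbf{S}_\pi$; $\Sigma^\pi$ is the set of $\pi$-factors. Patterns $\pi_1=(a_1,b_1,c_1,d_1),\pi_2=(a_2,b_2,c_2,d_2)$ are chainable if $a_1c_1/a_2=b_2d_2/d_1=:r(\pi_1,\pi_2)$ is an integer, $a_1\mid a_2$, $d_2\mid d_1$; then $\pi_1*\pi_2:=(a_1,b_1d_1/d_2,a_2c_2/a_1,d_2)$; such a pair is redundant if $r(\pi_1,\pi_2)\ge\min(b_1,c_2)$. An architecture $\beta=(\pi_\ell)_{\ell=1}^L$ is a sequence of patterns with $a_\ell c_\ell d_\ell=a_{\ell+1}b_{\ell+1}d_{\ell+1}$;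 it is chainable if consecutive pairs are chainable and redundant if some consecutive pair is redundant. $\pi_{[p,q]}:=\pi_p*\cdots*\pi_q$ (iterated product, well defined for chainable $\beta$). $\Sigma^\beta:=\Sigma^{\pi_1}\times\cdots\times\Sigma^{\pi_L}$. For $s\in\{1,\dots,L-1\}$, $\beta_s:=(\pi_{[1,s]},\pi_{[s+1,L]})$ and $E^{\beta_s}(\mathbf{A}):=\min_{\mathbf{X}\in\Sigma^{\pi_{[1,s]}},\mathbf{Y}\in\Sigma^{\pi_{[s+1,L]}}}\|\mathbf{A}-\mathbf{X}\mathbf{Y}\|_F$. For binary $\mathbf{L},\mathbf{R}$ with $\mathbf{U}_i:=\mathbf{L}[:,i]\mathbf{R}[i,:]$, $\mathcal{P}(\mathbf{L},\mathbf{R})$ is the partition of column indices of $\mathbf{L}$ into classes of the relation $\mathbf{U}_i=\mathbf{U}_j$, and $R_P\times C_P$ is the support of $\mathbf{U}_i$ for $i\in P$. TwoFactor$(\mathbf{M},\pi,\pi')$: zero $\mathbf{X},\mathbf{Y}$ of $\pi$-, $\pi'$-factor sizes; for each $P\in\mathcal{P}(\mathbf{S}_\pi,\mathbf{S}_{\pi'})$ set $(\mathbf{X}[R_P,P],\mathbf{Y}[P,C_P])$ to any minimizer $(\mathbf{H},\mathbf{K})$ of $\|\mathbf{M}[R_P,C_P]-\mathbf{H}\mathbf{K}\|_F$ over $\mathbf{H}\in\mathbb{C}^{|R_P|\times|P|},\mathbf{K}\in\mathbb{C}^{|P|\times|C_P|}$. Ortho$(\pi,\pi',\mathbf{X},\mathbf{Y},u)$: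 zero $\tilde{\mathbf{X}},\tilde{\mathbf{Y}}$; for each $P\in\mathcal{P}(\mathbf{S}_\pi,\mathbf{S}_{\pi'})$: if $u=$ column, QR-decompose $\mathbf{X}[R_P,P]=\mathbf{Q}\mathbf{R}$ and set $\tilde{\mathbf{X}}[R_P,P]=\mathbf{Q}$, $\tilde{\mathbf{Y}}[P,C_P]=\mathbf{R}\mathbf{Y}[P,C_P]$; if $u=$ row, QR-decompose $\mathbf{Y}[P,C_P]^\top=\mathbf{Q}\mathbf{R}$ and set $\tilde{\mathbf{X}}[R_P,P]=\mathbf{X}[R_P,P]\mathbf{R}^\top$, $\tilde{\mathbf{Y}}[P,C_P]=\mathbf{Q}^\top$. Butterfly algorithm: keep consecutive intervals $I_1,\dots,I_J$ partitioning $\{1,\dots,L\}$ with factors $\mathbf{X}_{I_k}$, initially $I_1=[1,L]$, $\mathbf{X}_{I_1}=\mathbf{A}$. For $J=1,\dots,L-1$: $s=\sigma_J$, $j$ with $s\in I_j=[q,t]$; for $k=1,\dots,j-1$: $(\mathbf{X}_{I_k},\mathbf{X}_{I_{k+1}})\leftarrow$ Ortho$(\pi_{I_k},\pi_{I_{k+1}},\mathbf{X}_{I_k},\mathbf{X}_{I_{k+1}},\text{column})$; for $k=J,\dots,j+1$ (decreasing): $(\mathbf{X}_{I_{k-1}},\mathbf{X}_{I_k})\leftarrow$ Ortho$(\pi_{I_{k-1}},\pi_{I_k},\mathbf{X}_{I_{k-1}},\mathbf{X}_{I_k},\text{row})$; then $(\mathbf{X}_{[q,s]},\mathbf{X}_{[s+1,t]})\leftarrow$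 TwoFactor$(\mathbf{X}_{I_j},\pi_{[q,s]},\pi_{[s+1,t]})$ and $I_j$ is replaced by $[q,s],[s+1,t]$. Output $(\mathbf{X}_{[\ell,\ell]})_{\ell=1}^L$. *)

(* Defs.v *)
(* with mathcomp-analysis reals (for [inf]) and
   mathcomp-real-closed complex numbers R[i]. *)
From HB Require Import structures.
From mathcomp Require Import all_boot all_order all_algebra.
From mathcomp Require Import classical_sets reals.
From mathcomp Require Import complex.
Set Implicit Arguments. Unset Strict Implicit. Unset Printing Implicit Defensive.
Import GRing.Theory Num.Theory.

(* Patterns  pi = (a,b,c,d) and their supports S_pi                     *)

Record pattern := Pat { pa : nat; pb : nat; pc : nat; pd : nat }.
Definition pat0 := Pat 1 1 1 1.

Definition pattern_pos (p : pattern) : bool :=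
  [&& 0 < pa p, 0 < pb p, 0 < pc p & 0 < pd p].

(* S_pi is an (a*b*d) x (a*c*d) matrix *)
Definition nrows (p : pattern) := pa p * pb p * pd p.
Definition ncols (p : pattern) := pa p * pc p * pd p.

(* S_pi = I_a (x) 1_{b x c} (x) I_d : row i = i1*(b*d) + i2*d + i3,
   column j = j1*(c*d) + j2*d + j3, entry 1 iff i1 = j1 and i3 = j3.
   (indices are 0-based) *)
Definition Spat (p : pattern) (i j : nat) : bool :=
  [&& i < nrows p, j < ncols p,
      i %/ (pb p * pd p) == j %/ (pc p * pd p) & i %% pd p == j %% pd p].

(* chainability of two patterns, r(pi1,pi2), product, redundancy *)
Definition chainable_pair (p1 p2 : pattern) : bool :=
  [&& pa p2 %| pa p1 * pc p1, pd p1 %| pb p2 * pd p2,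
      (pa p1 * pc p1) %/ pa p2 == (pb p2 * pd p2) %/ pd p1,
      pa p1 %| pa p2 & pd p2 %| pd p1].

Definition rpair (p1 p2 : pattern) : nat := (pa p1 * pc p1) %/ pa p2.

Definition star (p1 p2 : pattern) : pattern :=
  Pat (pa p1) (pb p1 * pd p1 %/ pd p2) (pa p2 * pc p2 %/ pa p1) (pd p2).

Definition redundant_pair (p1 p2 : pattern) : bool :=
  minn (pb p1) (pc p2) <= rpair p1 p2.

(* architectures: beta = (pi_1, ..., pi_L), 1-based access *)
Definition pat_at (beta : seq pattern) (l : nat) : pattern := nth pat0 beta l.-1.

Definition is_arch (beta : seq pattern) : Prop :=
  all pattern_pos beta /\
  forall l, 1 <= l < size beta -> ncols (pat_at beta l) = nrows (pat_at beta l.+1).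

Definition chainable_arch (beta : seq pattern) : Prop :=
  forall l, 1 <= l < size beta -> chainable_pair (pat_at beta l) (pat_at beta l.+1).

Definition redundant_arch (beta : seq pattern) : Prop :=
  exists l, 1 <= l < size beta /\ redundant_pair (pat_at beta l) (pat_at beta l.+1).

(* pi_[p,q] := pi_p * pi_{p+1} * ... * pi_q  (iterated, left to right) *)
Definition pint (beta : seq pattern) (p q : nat) : pattern :=
  foldl star (pat_at beta p) [seq pat_at beta l | l <- iota p.+1 (q - p)].

(* Complex matrices, represented as functions nat -> nat -> R[i]        *)
(* (dimensions carried by the patterns)                                 *)


Section Matrices.
Variable R : rcfType.
Local Notation C := R[i].

Definition mat := nat -> nat -> C.
Definition mat0 : mat := fun _ _ => 0%R.

(* product of X (m x k) and Y (k x n) *)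
Definition mmul (k : nat) (X Y : mat) : mat :=
  fun i j => (\sum_(l < k) X i l * Y l j)%R.
Definition msub (X Y : mat) : mat := fun i j => (X i j - Y i j)%R.

(* |z|^2 *)
Definition abs2 (z : C) : R := (complex.Re z ^+ 2 + complex.Im z ^+ 2)%R.

(* squared Frobenius norm and Frobenius norm of an m x n matrix *)
Definition frob2 (m n : nat) (X : mat) : R :=
  (\sum_(i < m) \sum_(j < n) abs2 (X i j))%R.
Definition frob (m n : nat) (X : mat) : R := Num.sqrt (frob2 m n X).

(* X is a pi-factor: an (abd x acd) matrix with support in supp(S_pi) *)
Definition is_factor (p : pattern) (X : mat) : Prop :=
  forall i j, ~~ Spat p i j -> X i j = 0%R.

(* product X_1 ... X_L of a chain of factors *)
Fixpoint chainprod (ps : seq pattern) (Xs : seq mat) : mat :=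
  match ps, Xs with
  | p :: ps', X :: Xs' =>
      match ps', Xs' with
      | [::], [::] => X
      | _, _ => mmul (ncols p) X (chainprod ps' Xs')
      end
  | _, _ => mat0
  end.

(* ---- the partition P(S_pi, S_pi') of the inner indices ---- *)
(* U_i = S_pi[:,i] S_pi'[i,:]; Ueq p p' i j <=> U_i = U_j *)
Definition Ueq (p p' : pattern) (i j : nat) : bool :=
  [forall r : 'I_(nrows p), forall c : 'I_(ncols p'),
     (Spat p r i && Spat p' i c) == (Spat p r j && Spat p' j c)].

(* j belongs to the class P of i *)
Definition inP (p p' : pattern) (i j : nat) : bool :=
  (j < ncols p) && Ueq p p' i j.

(* R_P x C_P = support of U_i, for the class P of i *)
Definition RP (p p' : pattern) (i r : nat) : bool :=
  [exists c : 'I_(ncols p'), Spat p r i && Spat p' i c].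
Definition CP (p p' : pattern) (i c : nat) : bool :=
  [exists r : 'I_(nrows p), Spat p r i && Spat p' i c].

(* X is zero outside the blocks X[R_P,P], Y zero outside the blocks Y[P,C_P] *)
Definition offblock0 (p p' : pattern) (X Y : mat) : Prop :=
  (forall r q, ~~ ((q < ncols p) && RP p p' q r) -> X r q = 0%R) /\
  (forall q c, ~~ ((q < ncols p) && CP p p' q c) -> Y q c = 0%R).

(* || M[R_P,C_P] - H K ||_F^2, H indexed by R_P x P, K by P x C_P *)
Definition blockerr (p p' : pattern) (M H K : mat) (i : nat) : R :=
  (\sum_(r < nrows p | RP p p' i r) \sum_(c < ncols p' | CP p p' i c)
     abs2 (M r c - \sum_(q < ncols p | inP p p' i q) H r q * K q c))%R.

(* TwoFactor(M, pi, pi') returns (X, Y) : relational (any minimizer) *)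
Definition TwoFactor (p p' : pattern) (M X Y : mat) : Prop :=
  offblock0 p p' X Y /\
  forall i, i < ncols p ->
    forall H K : mat, (blockerr p p' M X Y i <= blockerr p p' M H K i)%R.

(* Q (rows indexed by rowset, columns by the class cls) has orthonormal columns *)
Definition ortho_cols (rowset : nat -> bool) (nr : nat)
    (cls : nat -> bool) (k : nat) (Q : mat) : Prop :=
  forall p q, p < k -> q < k -> cls p -> cls q ->
    (\sum_(r < nr | rowset r) ((Q r p)^*)%C * Q r q = (p == q)%:R)%R.

(* Rm (indexed by cls x cls, in the natural order of indices) is upper triangular *)
Definition uptri (cls : nat -> bool) (Rm : mat) : Prop :=
  forall p q, cls p -> cls q -> (q < p)%N -> Rm p q = 0%R.

(* Ortho(pi, pi', X, Y, column) returns (X', Y') *)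
Definition OrthoCol (p p' : pattern) (X Y X' Y' : mat) : Prop :=
  offblock0 p p' X' Y' /\
  forall i, i < ncols p -> exists Q Rm : mat,
    [/\ ortho_cols (RP p p' i) (nrows p) (inP p p' i) (ncols p) Q,
        uptri (inP p p' i) Rm,
        (forall r q, RP p p' i r -> inP p p' i q ->
           X r q = (\sum_(t < ncols p | inP p p' i t) Q r t * Rm t q)%R),
        (forall r q, RP p p' i r -> inP p p' i q -> X' r q = Q r q) &
        (forall q c, inP p p' i q -> CP p p' i c ->
           Y' q c = (\sum_(t < ncols p | inP p p' i t) Rm q t * Y t c)%R)].

(* Ortho(pi, pi', X, Y, row) returns (X', Y'):
   Y[P,C_P]^T = Q Rm, X'[R_P,P] = X[R_P,P] Rm^T, Y'[P,C_P] = Q^T *)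
Definition OrthoRow (p p' : pattern) (X Y X' Y' : mat) : Prop :=
  offblock0 p p' X' Y' /\
  forall i, i < ncols p -> exists Q Rm : mat,
    [/\ ortho_cols (CP p p' i) (ncols p') (inP p p' i) (ncols p) Q,
        uptri (inP p p' i) Rm,
        (forall q c, inP p p' i q -> CP p p' i c ->
           Y q c = (\sum_(t < ncols p | inP p p' i t) Q c t * Rm t q)%R),
        (forall r q, RP p p' i r -> inP p p' i q ->
           X' r q = (\sum_(t < ncols p | inP p p' i t) X r t * Rm q t)%R) &
        (forall q c, inP p p' i q -> CP p p' i c -> Y' q c = Q c q)].

(* ---- states of the butterfly algorithm: intervals [lo,hi] + factors ---- *)
Record entry := Ent { lo : nat; hi : nat; emat : mat }.
Definition e0 := Ent 0 0 mat0.

Section Algo.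
Variable beta : seq pattern.

(* Ortho applied to the consecutive pair of entries (k, k+1) (0-based) *)
Definition ortho_step (col : bool) (k : nat) (st st' : seq entry) : Prop :=
  k.+1 < size st /\
  let e1 := nth e0 st k in let e2 := nth e0 st k.+1 in
  exists X1 X2 : mat,
    (if col then OrthoCol else OrthoRow)
       (pint beta (lo e1) (hi e1)) (pint beta (lo e2) (hi e2))
       (emat e1) (emat e2) X1 X2 /\
    st' = set_nth e0 (set_nth e0 st k (Ent (lo e1) (hi e1) X1))
                  k.+1 (Ent (lo e2) (hi e2) X2).

(* column sweep: pairs (0,1), (1,2), ..., (k-1,k) in this order *)
Inductive colsweep : nat -> seq entry -> seq entry -> Prop :=
| cs0 st : colsweep 0 st st
| csS k st st1 st2 :
    colsweep k st st1 -> ortho_step true k st1 st2 -> colsweep k.+1 st st2.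

(* row sweep: pairs (h-1,h) for h = hi, hi-1, ..., lo+1 in this order *)
Inductive rowsweep (lw : nat) : nat -> seq entry -> seq entry -> Prop :=
| rs0 st : rowsweep lw lw st st
| rsS h st st1 st2 : lw <= h ->
    ortho_step false h st st1 -> rowsweep lw h st1 st2 ->
    rowsweep lw h.+1 st st2.

(* one iteration J (= size st) of the main loop, with s = sigma_J *)
Definition bstep (s : nat) (st st'' : seq entry) : Prop :=
  exists (jj : nat) (st1 st2 : seq entry) (X1 X2 : mat),
    [/\ jj < size st,
        lo (nth e0 st jj) <= s < hi (nth e0 st jj),
        colsweep jj st st1,
        rowsweep jj (size st).-1 st1 st2 &
        let e := nth e0 st2 jj in
        TwoFactor (pint beta (lo e) s) (pint beta s.+1 (hi e)) (emat e) X1 X2 /\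
        st'' = take jj st2 ++ [:: Ent (lo e) s X1; Ent s.+1 (hi e) X2]
                 ++ drop jj.+1 st2].

(* bfly sigma A J st : st is a possible state after J iterations *)
Inductive bfly (sigma : seq nat) (A : mat) : nat -> seq entry -> Prop :=
| bf0 : bfly sigma A 0 [:: Ent 1 (size beta) A]
| bfS J st st' : bfly sigma A J st -> bstep (nth 0 sigma J) st st' ->
    bfly sigma A J.+1 st'.

End Algo.

(* output factor X_l (l 1-based) of a final state *)
Definition outX (st : seq entry) (l : nat) : mat := emat (nth e0 st l.-1).

End Matrices.

(* E^{beta_k}(A) = min over X in Sigma^{pi_[1,k]}, Y in Sigma^{pi_[k+1,L]}
   of ||A - X Y||_F (written as the infimum of the attained values) *)
Definition Ebeta (R : realType) (beta : seq pattern) (A : mat R) (k : nat) : R :=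
  let p1 := pint beta 1 k in
  let p2 := pint beta k.+1 (size beta) in
  inf [set x : R | exists X Y : mat R,
         [/\ is_factor p1 X, is_factor p2 Y &
             x = frob (nrows (pat_at beta 1)) (ncols (pat_at beta (size beta)))
                      (msub A (mmul (ncols p1) X Y))]].

(* Main.v *)
Require Import Defs.
From HB Require Import structures.
From mathcomp Require Import all_boot all_order all_algebra.
From mathcomp Require Import classical_sets reals.
From mathcomp Require Import complex.
From mathcomp Require Import boolp sesquilinear spectral ring lra zify.
Import Order.TTheory GRing.Theory Num.Theory.
Set Implicit Arguments.
Unset Strict Implicit.
Unset Printing Implicit Defensive.
Local Open Scope ring_scope.

(* For the order 1, ..., L-1 (the reverse order is its mirror image), let
   U = X_1 ... X_{J-1} be the product of the factors on the left after the
   column sweep of step J. On the supports at hand U acts isometrically, and the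
   last factor Z is the restriction of U^* A to its support: the current product
   was the best approximation of A by the U X Y of the previous step, so it is
   also best among the U Y. Hence |A - U Y|^2 = |A - U Z|^2 + |Z - Y|^2, and
   step J adds exactly the error of the best splitting X Y of Z. If X' Y is any
   competitor for E^{beta_J}(A), the restriction of U^* X' to the support of
   pi_J splits the restriction of U^* (X' Y), so by Bessel's inequality this
   error is at most |A - X' Y|. Rank deficient blocks need no separate
   treatment. The algorithm can be run because non-redundancy makes every block
   at least as tall and as wide as its class, which gives the QR factorizations,
   and because best low rank approximations exist (Eckart-Young). *)

(** * Matrices indexed by natural numbers *)

(** The left half of a fresh splitting is not orthonormal, and the next sweep rewrites all left
    factors by QR choices that need not be unique, so no formula for the last factor survives from
    one step to the next. The invariant stores optimality instead: the current pair is the best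
    among all pairs placed behind the prefix orthonormalized by the previous sweep. A new sweep
    changes that prefix only by a unitary matrix acting inside classes, which can be moved into the
    pair. Orthonormality is available only inside classes. This suffices because two inner indices
    that share a row of the left support and a column of the right support lie in one class. The
    comparison with [E^{beta_J}] rests on a second fact about supports, [sp_quad]: cutting [U^* X']
    down to the support of one pattern does not change its product with [Y] at the places that
    count. The pass is carried out for abstract supports whose axioms are symmetric under
    transposition, so that the reverse order is the same pass on the transpose of [A]. Matrices are
    functions on pairs of naturals, which keeps intervals and mirrored indices out of the types. *)

Section MatrixAlgebra.
Variable R : rcfType.
Implicit Types (X Y Z U M : mat R) (S : nat -> nat -> bool).

Definition madj X : mat R := fun i j => ((X j i)^*)%C.
Definition mtr X : mat R := fun i j => X j i.
Definition mid n : mat R := fun i j => ((i == j) && (i < n)%N)%:R.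
Definition mrestr S X : mat R := fun i j => if S i j then X i j else 0.
Definition supp_in S X := forall i j, ~~ S i j -> X i j = 0.
Definition ip m n X Y : R[i] :=
  \sum_(i < m) \sum_(j < n) ((X i j)^*)%C * Y i j.

Lemma matP X Y : (forall i j, X i j = Y i j) -> X = Y.
Proof. by move=> e; apply: funext => i; apply: funext => j. Qed.

Lemma mmulA k l X Y Z : mmul k (mmul l X Y) Z = mmul l X (mmul k Y Z).
Proof.
apply: matP => i j; rewrite /mmul.
under eq_bigr do rewrite mulr_suml.
under [RHS]eq_bigr do rewrite mulr_sumr.
rewrite exchange_big; apply: eq_bigr => t _; apply: eq_bigr => q _.
by rewrite mulrA.
Qed.

Lemma mtr_mmul k X Y : mtr (mmul k X Y) = mmul k (mtr Y) (mtr X).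
Proof. by apply: matP => i j; apply: eq_bigr => t _; rewrite mulrC. Qed.

Lemma madj_mmul k X Y : madj (mmul k X Y) = mmul k (madj Y) (madj X).
Proof.
apply: matP => i j; rewrite /madj /mmul rmorph_sum.
by apply: eq_bigr => t _; rewrite rmorphM mulrC.
Qed.

Lemma suppN S X i j : supp_in S X -> X i j != 0 -> S i j.
Proof. by move=> sX; apply: contraNT => /sX->. Qed.

Lemma supp_mrestr S X : supp_in S (mrestr S X).
Proof. by move=> i j /negPf nS; rewrite /mrestr nS. Qed.

(** Matrices live on all pairs of naturals, so [mid n] truncates; it is neutral only for a matrix
    whose support fits the size. *)
Lemma mmul_idl n (S : nat -> nat -> bool) X :
  (forall i j, S i j -> (i < n)%N) -> supp_in S X -> mmul n (mid n) X = X.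
Proof.
move=> Sn sX; apply: matP => i j; rewrite /mmul /mid.
case: (ltnP i n) => [lt_in|le_ni]; last first.
  rewrite (sX i j) ?big1 // => [k _|]; first by rewrite andbF mul0r.
  by apply/negP => /Sn; rewrite ltnNge le_ni.
rewrite (bigD1 (Ordinal lt_in)) //= eqxx mul1r big1 ?addr0 // => k.
by rewrite -val_eqE /= eq_sym => /negPf->; rewrite mul0r.
Qed.

Lemma mmul_idr n (S : nat -> nat -> bool) X :
  (forall i j, S i j -> (j < n)%N) -> supp_in S X -> mmul n X (mid n) = X.
Proof.
move=> Sn sX; apply: matP => i j; rewrite /mmul /mid.
case: (ltnP j n) => [lt_jn|le_nj]; last first.
  rewrite (sX i j) ?big1 // => [k _|].
    by case: eqP => [->|]; rewrite ?mulr0 // ltnNge le_nj mulr0.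
  by apply/negP => /Sn; rewrite ltnNge le_nj.
rewrite (bigD1 (Ordinal lt_jn)) //= eqxx lt_jn mulr1 big1 ?addr0 // => k.
by rewrite -val_eqE /= => /negPf->; rewrite mulr0.
Qed.

Lemma sum_neq0 (I : finType) (F : I -> R[i]) :
  \sum_i F i != 0 -> exists i, F i != 0.
Proof.
move=> nz; apply/existsP; apply: contraNT nz => /existsPn F0.
by rewrite big1 // => i _; have := F0 i; rewrite negbK => /eqP.
Qed.

Lemma mmul_neq0 k X Y i j :
  mmul k X Y i j != 0 -> exists t : 'I_k, X i t != 0 /\ Y t j != 0.
Proof.
by case/sum_neq0 => t; rewrite mulf_eq0 negb_or => /andP[]; exists t.
Qed.

Lemma abs2_ge0 (z : R[i]) : 0 <= abs2 z.
Proof. by rewrite addr_ge0 // sqr_ge0. Qed.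

Lemma abs2C (z : R[i]) : (abs2 z)%:C%C = (z^*)%C * z.
Proof. by rewrite /abs2 add_Re2_Im2 sqr_normc mulrC. Qed.

Lemma frob2_ge0 m n X : 0 <= frob2 m n X.
Proof. by rewrite !sumr_ge0 // => i _; rewrite sumr_ge0 // => j _; apply: abs2_ge0. Qed.

Lemma frob_sqr m n X : frob m n X ^+ 2 = frob2 m n X.
Proof. by rewrite sqr_sqrtr ?frob2_ge0. Qed.

Lemma frob2_ip m n X : (frob2 m n X)%:C%C = ip m n X X.
Proof.
rewrite /frob2 rmorph_sum; apply: eq_bigr => i _.
by rewrite rmorph_sum; apply: eq_bigr => j _; apply: abs2C.
Qed.

Lemma eq_frob2 m n X Y :
  (forall i j, (i < m)%N -> (j < n)%N -> X i j = Y i j) -> frob2 m n X = frob2 m n Y.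
Proof.
by move=> e; apply: eq_bigr => i _; apply: eq_bigr => j _; rewrite e.
Qed.

Lemma frob2_mtr m n X : frob2 m n (mtr X) = frob2 n m X.
Proof. by rewrite /frob2 exchange_big. Qed.

Lemma frob2_eq0 m n X i j :
  frob2 m n X <= 0 -> (i < m)%N -> (j < n)%N -> X i j = 0.
Proof.
move=> le0 im jn; have /eqP : frob2 m n X = 0.
  by apply/eqP; rewrite eq_le le0 frob2_ge0.
rewrite psumr_eq0 => [|k _]; last by apply: sumr_ge0 => l _; apply: abs2_ge0.
move=> /allP/(_ (Ordinal im) (mem_index_enum _))/=.
rewrite psumr_eq0 => [|l _]; last exact: abs2_ge0.
move=> /allP/(_ (Ordinal jn) (mem_index_enum _))/= /eqP abs0.
have := abs2C (X i j); rewrite abs0 => /esym/eqP.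
by rewrite mulf_eq0 conjc_eq0 orbb => /eqP.
Qed.

(** Restriction to [S] is the orthogonal projection onto the matrices supported in [S]. *)
Lemma ip_mrestr S m n Y M : supp_in S Y -> ip m n Y (mrestr S M) = ip m n Y M.
Proof.
move=> sY; apply: eq_bigr => i _; apply: eq_bigr => j _; rewrite /mrestr.
by case: ifPn => // /sY->; rewrite conjc0 !mul0r.
Qed.

Lemma ip_conj m n X Y : ip m n X Y = ((ip m n Y X)^*)%C.
Proof.
rewrite /ip rmorph_sum; apply: eq_bigr => i _.
rewrite rmorph_sum; apply: eq_bigr => j _.
by rewrite rmorphM /= conjcK mulrC.
Qed.

Lemma ip_msub m n X Y :
  ip m n (msub X Y) (msub X Y)
    = ip m n X X - ip m n X Y - ip m n Y X + ip m n Y Y.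
Proof.
rewrite /ip; transitivity (\sum_(i < m) \sum_(j < n)
    (((X i j)^*)%C * X i j - ((X i j)^*)%C * Y i j - ((Y i j)^*)%C * X i j
     + ((Y i j)^*)%C * Y i j)).
  apply: eq_bigr => i _; apply: eq_bigr => j _.
  by rewrite /msub rmorphB mulrBl !mulrBr opprB addrA addrAC.
under eq_bigr do rewrite big_split /= !sumrB.
by rewrite big_split /= !sumrB.
Qed.

Lemma ip_mmull m n k U Y M :
  ip m n (mmul k U Y) M = ip k n Y (mmul m (madj U) M).
Proof.
rewrite /ip [LHS]exchange_big [RHS]exchange_big /=; apply: eq_bigr => j _.
under eq_bigr do rewrite rmorph_sum mulr_suml.
rewrite exchange_big; apply: eq_bigr => q _.
rewrite /mmul mulr_sumr; apply: eq_bigr => i _.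
by rewrite /madj rmorphM mulrA; congr (_ * _); rewrite mulrC.
Qed.

(** [G] will be a Gram matrix. Column [j] of the product only involves indices [q'] with [Y q' j]
    nonzero, so [G] has to agree with the identity at those places alone. *)
Lemma mmul_delta k (G Y : mat R) q j :
  (q < k)%N ->
  (forall q', (q' < k)%N -> Y q' j != 0 -> G q q' = (q == q')%:R) ->
  mmul k G Y q j = Y q j.
Proof.
move=> qk oG; pose o := Ordinal qk; rewrite /mmul (bigD1 o) //= big1 ?addr0.
  have [->|Y0] := eqVneq (Y q j) 0; first by rewrite mulr0.
  by rewrite oG // eqxx mul1r.
move=> q' nq; have [->|Y0] := eqVneq (Y q' j) 0; first by rewrite mulr0.
by rewrite oG // -[q in q == _]/(val o) val_eqE eq_sym (negPf nq) mul0r.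
Qed.

(* The hypothesis on [U] says that its columns that meet a common column of
   the support of [Y] are orthonormal, so [U] acts isometrically on [Y]. *)
Lemma frob2_isometry m n k S U M Y :
  supp_in S Y ->
  (forall j q q', (q < k)%N -> (q' < k)%N -> S q j -> S q' j ->
     mmul m (madj U) U q q' = (q == q')%:R) ->
  let Z := mrestr S (mmul m (madj U) M) in
  frob2 m n (msub M (mmul k U Y)) = frob2 m n M - frob2 k n Z + frob2 k n (msub Z Y).
Proof.
move=> sY oU Z.
have UY : ip m n (mmul k U Y) (mmul k U Y) = ip k n Y Y.
  rewrite ip_mmull -mmulA; apply: eq_bigr => q _; apply: eq_bigr => j _.
  have [->|Y0] := eqVneq (Y q j) 0; first by rewrite conjc0 !mul0r.
  congr (_ * _); apply: mmul_delta => // q' q'k Y0'.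
  by apply: (oU j); rewrite ?(suppN sY).
have UM : ip m n (mmul k U Y) M = ip k n Y Z by rewrite ip_mmull ip_mrestr.
apply: complexI; rewrite rmorphD rmorphB /= !frob2_ip !ip_msub UY UM.
rewrite (ip_conj _ _ M (mmul k U Y)) UM -ip_conj; ring.
Qed.

End MatrixAlgebra.

(** * One pass over an abstract system of supports *)

(* [S p q] stands for the support of the factor of the interval [p, q], of size
   [D p.-1 x D q], and [cl s] for the classes of the partition of the inner
   indices at a split after [s]. The conditions are invariant under mirroring. *)
Record supp_sys (L : nat) (D : nat -> nat) (S : nat -> nat -> nat -> nat -> bool)
    (cl : nat -> nat -> nat -> bool) : Prop := SuppSys {
  sp_lt p q i j : (0 < p <= q)%N -> (q <= L)%N -> S p q i j ->
    (i < D p.-1)%N && (j < D q)%N;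
  sp_comp p s u i q j : (0 < p <= s)%N -> (s < u <= L)%N ->
    S p s i q -> S s.+1 u q j -> S p u i j;
  sp_quad p s s' u i q q' j : (0 < p <= s)%N -> (s < s')%N -> (s' < u <= L)%N ->
    S p s i q -> S s.+1 u q j -> S p s' i q' -> S s'.+1 u q' j -> S s.+1 s' q q';
  cl_of p s u i j t t' : (0 < p <= s)%N -> (s < u <= L)%N ->
    S p s i t -> S p s i t' -> S s.+1 u t j -> S s.+1 u t' j -> cl s t t';
  cl_l p s i t t' : (0 < p <= s)%N -> (s < L)%N -> cl s t t' -> S p s i t = S p s i t';
  cl_r s u t t' j : (0 < s)%N -> (s < u <= L)%N -> cl s t t' ->
    S s.+1 u t j = S s.+1 u t' j;
  cl_refl s t : (0 < s < L)%N -> (t < D s)%N -> cl s t t;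
  cl_lt s t t' : (0 < s < L)%N -> cl s t t' -> (t < D s)%N;
  cl_sym s t t' : (0 < s < L)%N -> cl s t t' -> cl s t' t;
  cl_trans s t t' t'' : (0 < s < L)%N -> cl s t t' -> cl s t' t'' -> cl s t t'' }.

Lemma sp_ltl L D S cl p q i j : supp_sys L D S cl ->
  (0 < p.+1 <= q)%N -> (q <= L)%N -> S p.+1 q i j -> (i < D p)%N.
Proof. by move=> H pq qL /(sp_lt H pq qL)/andP[]. Qed.

Lemma sp_ltr L D S cl p q i j : supp_sys L D S cl ->
  (0 < p <= q)%N -> (q <= L)%N -> S p q i j -> (j < D q)%N.
Proof. by move=> H pq qL /(sp_lt H pq qL)/andP[]. Qed.

(** Transposition and reversal of the chain: the interval [[p, q]] becomes [[L+1-q, L+1-p]], and the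
    cut after [s] the cut after [L-s]. *)
Lemma supp_sys_mirror L D S cl : supp_sys L D S cl ->
  supp_sys L (fun l => D (L - l)%N)
    (fun p q i j => S (L.+1 - q)%N (L.+1 - p)%N j i) (fun s => cl (L - s)%N).
Proof.
move=> H; split.
- move=> p q i j hp hq h; rewrite andbC.
  have -> : (L - p.-1)%N = (L.+1 - p)%N by lia.
  have -> : (L - q)%N = (L.+1 - q).-1 by lia.
  by apply: (sp_lt H _ _ h); lia.
- move=> p s u i q j hp hu h1 h2.
  apply: (@sp_comp _ _ _ _ H (L.+1 - u) (L - s) (L.+1 - p)%N j q i); try lia.
    by move: h2; rewrite subSS.
  by have -> : (L - s).+1 = (L.+1 - s)%N by lia.
- move=> p s s' u i q q' j hp hs hu; rewrite !subSS => h1 h2 h3 h4.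
  have -> : (L.+1 - s')%N = (L - s').+1 by lia.
  apply: (@sp_quad _ _ _ _ H (L.+1 - u) (L - s') (L - s) (L.+1 - p) j q' q i)%N => //; try lia.
    by have <- : (L.+1 - s')%N = (L - s').+1 by lia.
  by have <- : (L.+1 - s)%N = (L - s).+1 by lia.
- move=> p s u i j t t' hp hu; rewrite !subSS => h1 h2 h3 h4.
  apply: (@cl_of _ _ _ _ H (L.+1 - u) (L - s) (L.+1 - p) j i)%N => //; try lia.
    by have <- : (L.+1 - s)%N = (L - s).+1 by lia.
  by have <- : (L.+1 - s)%N = (L - s).+1 by lia.
- move=> p s i t t' hp hs c; have -> : (L.+1 - s)%N = (L - s).+1 by lia.
  by apply: (cl_r H) => //; lia.
- move=> s u t t' j hs hu c; rewrite subSS; apply: (cl_l H) => //; lia.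
- by move=> s t hs ht; apply: (cl_refl H) => //; lia.
- by move=> s t t' hs; apply: (cl_lt H); lia.
- by move=> s t t' hs; apply: (cl_sym H); lia.
- by move=> s t t' t'' hs; apply: (cl_trans H); lia.
Qed.

Section LeftToRight.
Variables (R : rcfType) (L : nat) (D : nat -> nat).
Variables (S : nat -> nat -> nat -> nat -> bool) (cl : nat -> nat -> nat -> bool).
Hypothesis H : supp_sys L D S cl.
Implicit Types (X : nat -> mat R) (Y Z U V W T M : mat R).

(** At [k = 0] the prefix is the empty product, that is the identity, with diagonal support and
    singleton classes; the first factor then needs no separate argument. *)
Definition S1 k i j := if k is 0%N then (i == j) && (i < D 0)%N else S 1 k i j.
Definition cl1 k t t' := if k is 0%N then (t == t') && (t < D 0)%N else cl k t t'.

Lemma S1_lt k i j : (k <= L)%N -> S1 k i j -> (i < D 0)%N && (j < D k)%N.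
Proof.
case: k => [_ /andP[/eqP <- ->] //|k kL]; exact: (sp_lt H).
Qed.

Lemma S1_comp k u i q j : (k < u <= L)%N -> S1 k i q -> S k.+1 u q j -> S 1 u i j.
Proof.
case: k => [_ /andP[/eqP-> _] //|k kL h1 h2]; exact: (sp_comp H _ _ h1 h2).
Qed.

Lemma S1_quad k u i q q' j : (k.+1 < u <= L)%N ->
  S1 k i q -> S k.+1 u q j -> S 1 k.+1 i q' -> S k.+2 u q' j -> S k.+1 k.+1 q q'.
Proof.
case: k => [_ /andP[/eqP-> _] //|k kL h1 h2 h3 h4]; exact: (sp_quad H _ _ _ h1 h2 h3 h4).
Qed.

Lemma cl1_of k u i j t t' : (k < u <= L)%N ->
  S1 k i t -> S1 k i t' -> S k.+1 u t j -> S k.+1 u t' j -> cl1 k t t'.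
Proof.
case: k => [_ /andP[/eqP<- lt] /andP[/eqP<- _] _ _|k kL h1 h2 h3 h4] /=.
  by rewrite eqxx.
exact: (cl_of H _ _ h1 h2 h3 h4).
Qed.

Lemma cl1_r k u t t' j : (k < u <= L)%N -> cl1 k t t' -> S k.+1 u t j = S k.+1 u t' j.
Proof. by case: k => [_ /andP[/eqP-> _] //|k kL /(cl_r H)]; apply. Qed.

Lemma cl1_refl k t : (k < L)%N -> (t < D k)%N -> cl1 k t t.
Proof. by case: k => [_ lt|k kL lt] /=; rewrite ?eqxx //; apply: (cl_refl H). Qed.

Lemma cl1_lt k t t' : (k < L)%N -> cl1 k t t' -> (t < D k)%N.
Proof. by case: k => [_ /andP[] //|k kL]; apply: (cl_lt H). Qed.

Lemma cl1_sym k t t' : (k < L)%N -> cl1 k t t' -> cl1 k t' t.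
Proof.
by case: k => [_ /andP[/eqP-> lt]|k kL] /=; rewrite ?eqxx //; apply: (cl_sym H).
Qed.

Lemma cl1_trans k t t' t'' : (k < L)%N -> cl1 k t t' -> cl1 k t' t'' -> cl1 k t t''.
Proof.
by case: k => [_ /andP[/eqP-> _] //|k kL]; apply: (cl_trans H).
Qed.

Definition lortho k U :=
  forall t t', cl1 k t t' -> mmul (D 0) (madj U) U t t' = (t == t')%:R.

(** A class-diagonal [T] only mixes rows of one class, and these have the same support on the
    right. *)
Lemma supp_mmul_cl k u T Y : (k < u <= L)%N ->
  supp_in (cl1 k) T -> supp_in (S k.+1 u) Y -> supp_in (S k.+1 u) (mmul (D k) T Y).
Proof.
move=> ku sT sY i j; apply: contraNeq => /mmul_neq0[t [/(suppN sT) c /(suppN sY)]].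
by rewrite (cl1_r _ ku c).
Qed.

Lemma supp_madj_cl k T : (k < L)%N -> supp_in (cl1 k) T -> supp_in (cl1 k) (madj T).
Proof.
move=> kL sT i j; apply: contraNeq; rewrite /madj conjc_eq0 => /(suppN sT).
exact: cl1_sym.
Qed.

(** Columns of [U] with a nonzero inner product share a row; if they also meet a common column [j]
    on the right, [cl1_of] puts them in one class, where [lortho] applies. Without the common [j],
    columns of different classes are not controlled. *)
Lemma lorthoE k u U j q q' : (k < u <= L)%N -> supp_in (S1 k) U -> lortho k U ->
  S k.+1 u q j -> S k.+1 u q' j -> mmul (D 0) (madj U) U q q' = (q == q')%:R.
Proof.
move=> ku sU oU h h'; have [e|ne] := eqVneq q q'.
  rewrite oU e ?eqxx //; apply: cl1_refl; first lia.
  by rewrite -e; apply: (sp_ltl H _ _ h); lia.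
apply/eqP; apply: contraT => nz; case/mmul_neq0: (nz) => i [].
rewrite /madj conjc_eq0 => /(suppN sU) h1 /(suppN sU) h2.
by rewrite oU ?(negPf ne) ?eqxx // in nz; apply: (cl1_of ku h1 h2 h h').
Qed.

(** In [Q^* (U^* U) Q] at two columns of one class, all row indices that occur lie in a common
    column of the support of [Q] by [cl_l], so [U^* U] acts there as the identity. *)
Lemma lortho_mmul k U Q : (k.+1 < L)%N -> supp_in (S1 k) U -> lortho k U ->
  supp_in (S k.+1 k.+1) Q ->
  (forall t t', cl k.+1 t t' -> mmul (D k) (madj Q) Q t t' = (t == t')%:R) ->
  lortho k.+1 (mmul (D k) U Q).
Proof.
move=> kL sU oU sQ oQ t t' c; rewrite madj_mmul mmulA -(mmulA _ _ (madj U)).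
rewrite -oQ //; apply: eq_bigr => a _; have [->|] := eqVneq (madj Q t a) 0.
  by rewrite !mul0r.
rewrite {1}/madj conjc_eq0 => /(suppN sQ) h; congr (_ * _).
have kk : (0 < k.+1 <= k.+1)%N by lia.
apply: mmul_delta => // b _ /(suppN sQ); rewrite -(cl_l H _ kk kL c) => h'.
by apply: (lorthoE _ sU oU h h'); lia.
Qed.

(* [T] intertwines two orthonormal families, so it is unitary and
   [U = U' T] can be solved for [U']. *)
Lemma unitary_change k U U' T : (k < L)%N -> supp_in (S1 k) U' ->
  lortho k U -> lortho k U' -> supp_in (cl1 k) T ->
  U = mmul (D k) U' T -> U' = mmul (D k) U (madj T).
Proof.
move=> kL sU' oU oU' sT eU.
(* Inside a class the Gram matrices of [U] and [U'] are both the identity and are related by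
   [U^* U = T^* (U'^* U') T]; across classes [T^* T] vanishes by its support. *)
have TT : mmul (D k) (madj T) T = mid R (D k).
  apply: matP => t q; rewrite /mid; case: (boolP (cl1 k t q)) => c.
    rewrite (cl1_lt kL c) andbT -(oU _ _ c) eU madj_mmul mmulA -(mmulA _ _ (madj U')).
    apply: eq_bigr => a _; have [->|] := eqVneq (madj T t a) 0; first by rewrite !mul0r.
    rewrite {1}/madj conjc_eq0 => /(suppN sT) h; congr (_ * _); apply/esym.
    apply: mmul_delta => // b _ /(suppN sT) h'; apply: oU'.
    by apply: (cl1_trans kL h); apply: (cl1_trans kL c); apply: (cl1_sym kL).
  have -> : (t == q) && (t < D k)%N = false.
    by apply: contraNF c => /andP[/eqP<-]; apply: cl1_refl.
  apply/eqP; apply: contraNT c => /mmul_neq0[a []].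
  rewrite {1}/madj conjc_eq0 => /(suppN sT) h /(suppN sT) h'.
  by apply: (cl1_trans kL _ h'); apply: cl1_sym.
(* [T] is square of size [D k], so a left inverse is a right inverse; the detour through finite
   matrices gives access to this. *)
have TT' : mmul (D k) T (madj T) = mid R (D k).
  pose T0 : 'M[R[i]]_(D k) := \matrix_(i, j) T i j.
  pose T1 : 'M[R[i]]_(D k) := \matrix_(i, j) madj T i j.
  have /mulmx1C/matrixP e : T1 *m T0 = 1%:M.
    apply/matrixP => i j; rewrite !mxE.
    move: TT => /(congr1 (fun M : mat R => M i j)); rewrite /mid ltn_ord andbT.
    by rewrite val_eqE => <-; apply: eq_bigr => a _; rewrite !mxE.
  have sT' := supp_madj_cl kL sT.
  apply: matP => i j; case: (ltnP i (D k)) => ik; last first.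
    rewrite /mid (leq_gtF ik) andbF; apply: big1 => a _.
    rewrite (sT i a) ?mul0r //; apply/negP => /(cl1_lt kL); lia.
  case: (ltnP j (D k)) => jk; last first.
    rewrite /mid; have -> : (i == j) = false by lia.
    apply: big1 => a _; rewrite (sT' a j) ?mulr0 //.
    by apply/negP => /(cl1_sym kL)/(cl1_lt kL); lia.
  have := e (Ordinal ik) (Ordinal jk); rewrite !mxE /mid ik andbT => <-.
  by apply: eq_bigr => a _; rewrite !mxE.
rewrite eU mmulA TT'; apply/esym/(mmul_idr _ sU') => i j /(S1_lt (ltnW kL)).
by case/andP.
Qed.

(** Factors are counted from 0: [X k] belongs to the single pattern [k+1]. The matrix [T] collects
    the triangular factors of all blocks. *)
Definition aortho k (X X' : nat -> mat R) := exists T : mat R,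
  [/\ supp_in (cl k.+1) T, supp_in (S k.+1 k.+1) (X' k),
      (forall t t', cl k.+1 t t' ->
         mmul (D k) (madj (X' k)) (X' k) t t' = (t == t')%:R),
      X k = mmul (D k.+1) (X' k) T /\ X' k.+1 = mmul (D k.+1) T (X k.+1) &
      forall j, j != k -> j != k.+1 -> X' j = X j].

Inductive asweep (a : nat) : nat -> (nat -> mat R) -> (nat -> mat R) -> Prop :=
| asweep0 X : asweep a a X X
| asweepS k X X1 X2 : asweep a k X X1 -> aortho k X1 X2 -> asweep a k.+1 X X2.

Lemma asweepS_inv k X X2 : asweep 0 k.+1 X X2 ->
  exists2 X1, asweep 0 k X X1 & aortho k X1 X2.
Proof. by move=> sw; inversion sw as [|k' Y0 Y1 Y2 sw1 o]; exists Y1. Qed.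

(** [asweep] grows at its last step, a row sweep at its first one; a step is added at the front for
    the mirrored row sweep. *)
Lemma asweep_cons a b X X1 X2 :
  aortho a X X1 -> asweep a.+1 b X1 X2 -> asweep a b X X2.
Proof.
move=> h; move: {-2}a.+1 (erefl a.+1) => a' ea sw; elim: sw ea h => [Y ea|k Y X3 X4 sw IH o ea] h.
  by rewrite ea; apply: asweepS h; apply: asweep0.
by apply: asweepS o; apply: IH.
Qed.

Fixpoint pprod k (X : nat -> mat R) : mat R :=
  if k is k'.+1 then mmul (D k') (pprod k' X) (X k') else mid R (D 0).

Lemma eq_pprod k X X' : (forall j, (j < k)%N -> X j = X' j) -> pprod k X = pprod k X'.
Proof.
elim: k => //= k IH e; rewrite e // IH // => j jk; apply: e; exact: leq_trans jk _.
Qed.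

Lemma supp_pprod k X : (k <= L)%N -> (forall j, (j < k)%N -> supp_in (S j.+1 j.+1) (X j)) ->
  supp_in (S1 k) (pprod k X).
Proof.
elim: k => [_ _ i j|k IH kL sX i j] /=; first by rewrite /mid => /negPf->.
apply: contraNeq => /mmul_neq0[t []] /(suppN (IH (ltnW kL) _)) h1.
move=> /(suppN (sX k _)) h2; apply: (S1_comp _ (h1 _) (h2 _)) => // [|j0 j0k].
  by rewrite ltnSn.
by apply: sX; lia.
Qed.

Lemma lortho_mid : lortho 0 (mid R (D 0)).
Proof.
move=> t t' /andP[/eqP<- lt]; rewrite mmul_delta ?/mid ?eqxx ?lt // => q' lt' _.
by rewrite /madj lt' andbT eq_sym conjc_nat.
Qed.

(** The correction [T] leaves the prefix and is absorbed by factor [k], so the product through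
    factor [k] is unchanged. The right end [u] is general because the last factor belongs to a long
    interval, the earlier ones to single patterns. *)
Lemma asweepP k u X X1 : asweep 0 k X X1 -> (k < u <= L)%N ->
  (forall j, (j < k)%N -> supp_in (S j.+1 j.+1) (X j)) -> supp_in (S k.+1 u) (X k) ->
  exists T : mat R,
  [/\ supp_in (cl1 k) T, pprod k X = mmul (D k) (pprod k X1) T,
      X1 k = mmul (D k) T (X k), forall j, (k < j)%N -> X1 j = X j &
      (forall j, (j < k)%N -> supp_in (S j.+1 j.+1) (X1 j)) /\ lortho k (pprod k X1)].
Proof.
move=> sw; elim: sw u => [X0 u uL _ sX|k0 X0 X2 X3 sw IH [T [sT sQ oQ [e1 e2] e3]] u ku sX sXk] /=.
  exists (mid R (D 0)); split=> //.
  - by move=> i j /=; rewrite /mid => /negPf->.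
  - apply/esym/(@mmul_idl _ _ (fun i j => (i == j) && (i < D 0)%N)) => [i j /andP[]//|].
    by move=> i j; rewrite /mid => /negPf->.
  - apply/esym/(mmul_idl _ sX) => i j h; apply: (sp_ltl H _ _ h); lia.
  by split=> //; apply: lortho_mid.
have k0L : (k0 < L)%N by lia.
have [|||T0 [sT0 p0 x0 r0 [s0 o0]]] := IH k0.+1; first lia.
  by move=> j jk; apply: sX; lia.
  exact: sX.
have eP : pprod k0 X3 = pprod k0 X2 by apply: eq_pprod => j jk; apply: e3; lia.
exists T; split=> //.
- by rewrite p0 mmulA -x0 e1 -mmulA eP.
- by rewrite e2 r0.
- by move=> j kj; rewrite e3 ?r0 //; lia.
have s3 j : (j < k0.+1)%N -> supp_in (S j.+1 j.+1) (X3 j).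
  have [-> //|ne jk] := eqVneq j k0.
  by have -> : X3 j = X2 j; [apply: e3 | apply: s0]; lia.
split=> //; rewrite eP; apply: lortho_mmul => //; first lia.
by apply: supp_pprod => //; lia.
Qed.

Lemma frob2_msubxx m n Y : frob2 m n (msub Y Y) = 0.
Proof.
by apply: big1 => i _; apply: big1 => j _; rewrite /msub subrr /abs2 /= expr0n /= addr0.
Qed.

(** Global form of the blockwise minimality in [TwoFactor]; it does not mention classes and is easy
    to mirror. *)
Definition best_fac p s u M W V :=
  [/\ supp_in (S p s) W, supp_in (S s.+1 u) V &
   forall W' V', supp_in (S p s) W' -> supp_in (S s.+1 u) V' ->
     frob2 (D p.-1) (D u) (msub M (mmul (D s) W V))
       <= frob2 (D p.-1) (D u) (msub M (mmul (D s) W' V'))].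

Definition astep J (X X' : nat -> mat R) := exists X1,
  [/\ asweep 0 J X X1, forall j, (j < J)%N -> X' j = X1 j &
      best_fac J.+1 J.+1 L (X1 J) (X' J) (X' J.+1)].

(** * The invariant of the pass *)

Variables (A : mat R) (e : nat -> R).
Local Notation err N := (frob2 (D 0) (D L) (msub A N)).
(** This is how a squared infimum enters: [e k] dominates every lower bound of the squared errors of
    a splitting at [k]. *)
Hypothesis e_ge : forall k x, (0 < k < L)%N ->
  (forall W V, supp_in (S 1 k) W -> supp_in (S k.+1 L) V ->
     x <= err (mmul (D k) W V)) -> x <= e k.

(** State after [J] cuts. Orthonormality stops after [J-1] factors, since those with indices [J-1]
    and [J] come fresh from the last splitting; the fourth clause says that this pair is the best
    one behind the prefix of the others. *)
Definition run_inv J (X : nat -> mat R) :=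
  [/\ forall j, (j < J)%N -> supp_in (S j.+1 j.+1) (X j),
      supp_in (S J.+1 L) (X J), lortho J.-1 (pprod J.-1 X),
      forall W V, supp_in (S J J) W -> supp_in (S J.+1 L) V ->
        err (mmul (D J) (pprod J X) (X J))
          <= err (mmul (D J) (mmul (D J.-1) (pprod J.-1 X) W) V) &
      err (mmul (D J) (pprod J X) (X J)) <= \sum_(1 <= k < J.+1) e k].

Lemma run_inv1 X : (1 < L)%N -> best_fac 1 1 L A (X 0%N) (X 1%N) -> run_inv 1 X.
Proof.
move=> L1 [s0 s1 best].
have idl W : supp_in (S 1 1) W -> mmul (D 0) (mid R (D 0)) W = W.
  move=> sW; apply: (mmul_idl _ sW) => i j h; apply: (sp_ltl H _ _ h); lia.
split=> [[]||||] //=; first exact: lortho_mid.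
  by move=> W V sW sV; rewrite !idl //; apply: best.
by rewrite big_nat1 idl //; apply: e_ge.
Qed.

(* The sweep only changes the representation of the current product, which was
   optimal given the span of its left factors; hence the last factor is the
   restriction of [U^* A] to its support, and the error of the next splitting
   adds to the current one by Pythagoras. *)
Lemma run_invS J X X' : (0 < J)%N -> (J.+1 < L)%N ->
  run_inv J X -> astep J X X' -> run_inv J.+1 X'.
Proof.
move=> J0 JL [sX sXJ oX opt bnd] [X1 [sw eX' [sW sV best]]].
have [|T [sT eP eZ _ [sX1 oX1]]] := asweepP sw _ sX sXJ; first lia.
have eP' : pprod J X' = pprod J X1 by apply: eq_pprod.
set U := pprod J X1 in eP oX1 eP'; set Z := X1 J in eZ best.
have sU : supp_in (S1 J) U by apply: supp_pprod => //; lia.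
have sZ : supp_in (S J.+1 L) Z by rewrite eZ; apply: supp_mmul_cl => //; lia.
have oU j q q' : (q < D J)%N -> (q' < D J)%N -> S J.+1 L q j -> S J.+1 L q' j ->
    mmul (D 0) (madj U) U q q' = (q == q')%:R.
  by move=> _ _ h h'; apply: (lorthoE _ sU oX1 h h'); lia.
(* Up to a constant, the error of [U Y] is the squared distance from [Y] to [Zs], the restriction of
   [U^* A]. *)
have errU Y : supp_in (S J.+1 L) Y -> err (mmul (D J) U Y) = _ :=
  fun sY => frob2_isometry (D L) A sY oU.
move: errU; set Zs := mrestr _ _ => /= errU.
have sZs : supp_in (S J.+1 L) Zs by apply: supp_mrestr.
have optU Y : supp_in (S J.+1 L) Y -> err (mmul (D J) U Z) <= err (mmul (D J) U Y).
  move=> sY; have eJ : J = J.-1.+1 by lia.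
  (* The last orthogonalization is split off, so that [U] is the prefix of [X0] times [X1 J.-1]. The
     prefix of [X0] is the old one times the adjoint of [T0]; hence [U Y] is the old prefix times
     the pair of [T0^* X1 J.-1] and [Y], a competitor in the invariant. *)
  have [X0 sw0 [T1 [_ sQ _ _ eX1]]] : exists2 X0, asweep 0 J.-1 X X0 & aortho J.-1 X0 X1.
    by apply: asweepS_inv; rewrite -eJ.
  rewrite -eJ in sQ eX1.
  have sX' j : (j < J.-1)%N -> supp_in (S j.+1 j.+1) (X j) by move=> jJ; apply: sX; lia.
  have sXJ' : supp_in (S J.-1.+1 J) (X J.-1) by have := sX J.-1; rewrite -eJ; apply; lia.
  have [|T0 [sT0 eP0 _ _ [sX0 oX0]]] := asweepP sw0 _ sX' sXJ'; first lia.
  have eU : U = mmul (D J.-1) (pprod J.-1 X0) (X1 J.-1).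
    rewrite /U {1}eJ /=; congr mmul.
    by apply: eq_pprod => j jJ; apply: eX1; lia.
  have sP0 : supp_in (S1 J.-1) (pprod J.-1 X0) by apply: supp_pprod => //; lia.
  have J1L : (J.-1 < L)%N by lia.
  rewrite eU (unitary_change J1L sP0 oX oX0 sT0 eP0) (mmulA _ _ _ (madj T0)).
  have -> : mmul (D J) (mmul (D J.-1) (pprod J.-1 X) (mmul (D J.-1) (madj T0) (X1 J.-1))) Z
      = mmul (D J) (pprod J X) (X J).
    by rewrite -mmulA -(unitary_change J1L sP0 oX oX0 sT0 eP0) -eU eP mmulA -eZ.
  apply: opt => //; have := supp_mmul_cl (u := J) _ (supp_madj_cl J1L sT0).
  by rewrite -eJ; apply => //; lia.
(* The competitor [Zs] has an error smaller by the squared norm of [Zs - Z], which must therefore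
   vanish. *)
have eZs : Z = Zs.
  have := optU _ sZs; rewrite !errU // => le0.
  have le1 : frob2 (D J) (D L) (msub Zs Z) <= 0.
    by move: le0; rewrite frob2_msubxx; lra.
  apply: matP => i j; case: (boolP (S J.+1 L i j)) => h; last by rewrite sZ ?sZs.
  have iJ : (i < D J)%N by apply: (sp_ltl H _ _ h); lia.
  have jL : (j < D L)%N by apply: (sp_ltr H _ _ h); lia.
  by have /subr0_eq := frob2_eq0 le1 iJ jL.
(* With [Y] the restriction of [U^* M] itself, [frob2_isometry] reads
   [|M - U Y|^2 = |M|^2 - |Y|^2]. *)
have bessel M : frob2 (D J) (D L) (mrestr (S J.+1 L) (mmul (D 0) (madj U) M))
    <= frob2 (D 0) (D L) M.
  have s0 : supp_in (S J.+1 L) (mrestr (S J.+1 L) (mmul (D 0) (madj U) M)) by apply: supp_mrestr.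
  have := frob2_isometry (D L) M s0 oU; set Y := mrestr _ _.
  rewrite /= frob2_msubxx.
  have := frob2_ge0 (D 0) (D L) (msub M (mmul (D J) U Y)); lra.
have sWV W V : supp_in (S J.+1 J.+1) W -> supp_in (S J.+2 L) V ->
    supp_in (S J.+1 L) (mmul (D J.+1) W V).
  move=> sW' sV' i j; apply: contraNeq => /mmul_neq0[t [/(suppN sW') h /(suppN sV') h']].
  by apply: (sp_comp H _ _ h h'); lia.
have errWV W V : supp_in (S J.+1 J.+1) W -> supp_in (S J.+2 L) V ->
    err (mmul (D J.+1) (mmul (D J) U W) V)
      = err (mmul (D J) U Z) + frob2 (D J) (D L) (msub Z (mmul (D J.+1) W V)).
  move=> sW' sV'; rewrite mmulA !errU // ?sWV //; last exact: sWV.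
  by rewrite -eZs frob2_msubxx; lra.
split=> /=; rewrite ?eP' //.
- move=> j jJ; have [->//|ne] := eqVneq j J.
  by have -> : X' j = X1 j; [apply: eX' | apply: sX1]; lia.
- by move=> W V sW' sV'; rewrite !errWV // lerD2l; apply: best.
rewrite errWV // big_nat_recr //=; apply: lerD.
  by move: bnd; rewrite eP mmulA -eZ.
apply: e_ge => [|Xh V sXh sV']; first lia.
pose W := mrestr (S J.+1 J.+1) (mmul (D 0) (madj U) Xh).
apply: le_trans (best W V _ sV') _; first exact: supp_mrestr.
apply: le_trans (bessel _); rewrite eZs le_eqVlt; apply/orP; left; apply/eqP.
apply: eq_frob2 => i j iJ jL; rewrite /msub /Zs /mrestr; case: ifP => h.
  have -> : mmul (D 0) (madj U) (msub A (mmul (D J.+1) Xh V)) i j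
      = mmul (D 0) (madj U) A i j - mmul (D 0) (madj U) (mmul (D J.+1) Xh V) i j.
    by rewrite /mmul -sumrB; apply: eq_bigr => t _; rewrite -mulrBr.
  congr (_ - _); rewrite -mmulA; apply: eq_bigr => t _.
  have [->|/(suppN sV') ht] := eqVneq (V t j) 0; first by rewrite !mulr0.
  (* Where [V t j] is nonzero the cut loses nothing: a nonzero entry [(i, t)] of [U^* Xh] yields a
     row [r] linked to both [i] and [t], and [S1_quad] then puts [(i, t)] in the support of pattern
     [J+1]. *)
  congr (_ * _); rewrite /W /mrestr; case: ifPn => // /negP nS; apply/esym/eqP.
  apply: contraT => /mmul_neq0[r []]; rewrite {1}/madj conjc_eq0.
  move=> /(suppN sU) h1 /(suppN sXh) h2; case: nS.
  by apply: (S1_quad _ h1 h h2 ht); lia.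
by rewrite sWV ?subrr ?h //; apply: supp_mrestr.
Qed.

End LeftToRight.

(** * Supports of a chainable architecture *)

Section Patterns.
Local Open Scope nat_scope.
Variable beta : seq pattern.
Hypotheses (arch : is_arch beta) (chain : chainable_arch beta).
Local Notation L := (size beta).
Local Notation pa_ l := (pa (pat_at beta l)).
Local Notation pb_ l := (pb (pat_at beta l)).
Local Notation pc_ l := (pc (pat_at beta l)).
Local Notation pd_ l := (pd (pat_at beta l)).

Definition Dim l := if l is 0 then nrows (pat_at beta 1) else ncols (pat_at beta l).
Definition Sup p q := Spat (pint beta p q).
(** Closed form of the partition at the cut after [s], identified by [inPE]. Neither end of the
    interval being split occurs in it, so one relation serves all intervals cut at [s]. *)
Definition Cls s t t' :=
  [&& t < Dim s, t' < Dim s,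
      t %/ (Dim s %/ pa_ s.+1) == t' %/ (Dim s %/ pa_ s.+1) & t %% pd_ s == t' %% pd_ s].

Lemma pat_pos l : 0 < l <= L -> [/\ 0 < pa_ l, 0 < pb_ l, 0 < pc_ l & 0 < pd_ l].
Proof.
case: arch => /all_nthP pos _ lL.
have h : l.-1 < L by lia.
by have /and4P[] := pos pat0 _ h.
Qed.

Lemma DimE l : 0 < l <= L -> Dim l.-1 = pa_ l * pb_ l * pd_ l.
Proof.
case: l => // [[|l]] lL //=; case: arch => _ /(_ l.+1) ->; [by []|lia].
Qed.

Lemma pa_dvd1 l : 0 < l < L -> pa_ l %| pa_ l.+1.
Proof. by move=> /chain/and5P[]. Qed.

Lemma pd_dvd1 l : 0 < l < L -> pd_ l.+1 %| pd_ l.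
Proof. by move=> /chain/and5P[]. Qed.

Lemma pa_dvd l m : 0 < l <= m -> m <= L -> pa_ l %| pa_ m.
Proof.
case/andP=> l0 lm; rewrite -(subnKC lm); elim: (m - l) => [|k IH] kL.
  by rewrite addn0.
rewrite addnS; apply: dvdn_trans (pa_dvd1 _); [apply: IH|]; lia.
Qed.

Lemma pd_dvd l m : 0 < l <= m -> m <= L -> pd_ m %| pd_ l.
Proof.
case/andP=> l0 lm; rewrite -(subnKC lm); elim: (m - l) => [|k IH] kL.
  by rewrite addn0.
rewrite addnS; apply: dvdn_trans (pd_dvd1 _) (IH _); lia.
Qed.

Lemma pa_dvd_Dim l m : 0 < l -> l <= m.+1 <= L -> pa_ l %| Dim m.
Proof.
move=> l0 lm; apply: dvdn_trans (pa_dvd (m := m.+1) _ _) _; try lia.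
by rewrite (@DimE m.+1) ?ltnS -?mulnA ?dvdn_mulr //; lia.
Qed.

Lemma pa_dvd_Dimr l m : 0 < l <= m -> m <= L -> pa_ l %| Dim m.
Proof.
move=> lm mL; apply: dvdn_trans (pa_dvd lm mL) _.
case: m lm {mL} => [|m] lm; first lia.
by rewrite /= /ncols -mulnA dvdn_mulr.
Qed.

Lemma pintS p q : p <= q -> pint beta p q.+1 = star (pint beta p q) (pat_at beta q.+1).
Proof.
move=> pq; have e : q.+1 - p = (q - p) + 1 by lia.
rewrite /pint e iotaD map_cat foldl_cat /=.
by rewrite addSn subnKC.
Qed.

Lemma pintxx p : pint beta p p = pat_at beta p.
Proof. by rewrite /pint subnn. Qed.

(** The divisions in [star] are exact along the chain: [b d] is fixed by the left end and [a c] by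
    the right end. *)
Lemma pint_params p q : 0 < p <= q -> q <= L ->
  [/\ pa (pint beta p q) = pa_ p, pd (pint beta p q) = pd_ q,
      pb (pint beta p q) * pd_ q = pb_ p * pd_ p &
      pa_ p * pc (pint beta p q) = pa_ q * pc_ q].
Proof.
case/andP=> p0 pq; rewrite -(subnKC pq); elim: (q - p) => [|k IH] kL.
  by rewrite addn0 pintxx.
have [|e1 e2 e3 e4] := IH _; first lia.
rewrite addnS pintS /star /=; last lia.
split=> //.
  rewrite divnK ?e2 ?e3 //; apply: dvdn_mull; apply: pd_dvd; lia.
by rewrite e1 mulnC divnK // dvdn_mulr // pa_dvd //; lia.
Qed.

Lemma nrows_pint p q : 0 < p <= q -> q <= L -> nrows (pint beta p q) = Dim p.-1.
Proof.
move=> pq qL; have [e1 e2 e3 e4] := pint_params pq qL.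
by rewrite /nrows e1 e2 -mulnA e3 DimE ?mulnA //; lia.
Qed.

Lemma ncols_pint p q : 0 < p <= q -> q <= L -> ncols (pint beta p q) = Dim q.
Proof.
move=> pq qL; have [e1 e2 e3 e4] := pint_params pq qL.
have -> : Dim q = ncols (pat_at beta q) by case: (q) pq => // /andP[]; lia.
by rewrite /ncols e1 e2 e4.
Qed.

(** The two ends of the interval separate: the left one enters through the number of a block among
    [a_p], the right one through the residue modulo [d_q]. *)
Lemma SupE p q i j : 0 < p <= q -> q <= L ->
  Sup p q i j = [&& i < Dim p.-1, j < Dim q,
    i %/ (Dim p.-1 %/ pa_ p) == j %/ (Dim q %/ pa_ p) & i %% pd_ q == j %% pd_ q].
Proof.
move=> pq qL; rewrite /Sup /Spat nrows_pint // ncols_pint //.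
have [e1 e2 e3 e4] := pint_params pq qL; rewrite e2 e3.
have /pat_pos[pa0 _ _ _] : 0 < p <= L by lia.
rewrite (@DimE p) -?mulnA ?mulKn //; last lia.
have -> : Dim q = pa_ p * (pc (pint beta p q) * pd_ q).
  by rewrite -(ncols_pint pq qL) /ncols e1 e2 mulnA.
by rewrite mulKn.
Qed.

Lemma Dim_blk p p' s : 0 < p <= p' -> p' <= L -> pa_ p' %| Dim s ->
  Dim s %/ pa_ p = Dim s %/ pa_ p' * (pa_ p' %/ pa_ p).
Proof.
move=> pp' p'L dv; have /pat_pos[p0 _ _ _] : 0 < p <= L by lia.
apply/eqP; rewrite eq_sym eqn_div //; last by apply: dvdn_trans dv; apply: pa_dvd.
by rewrite -mulnA divnK ?pa_dvd // divnK.
Qed.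

(** As [a_p] divides [a_p'], each block for [p] is a union of consecutive blocks for [p']. *)
Lemma blk_coarsen p p' s s' i j : 0 < p <= p' -> p' <= L ->
  pa_ p' %| Dim s -> pa_ p' %| Dim s' ->
  i %/ (Dim s %/ pa_ p') = j %/ (Dim s' %/ pa_ p') ->
  i %/ (Dim s %/ pa_ p) = j %/ (Dim s' %/ pa_ p).
Proof.
by move=> pp' p'L d1 d2 e; rewrite !(Dim_blk pp' p'L) // !divnMA e.
Qed.

Lemma eq_modn_dvd d d' i j : d' %| d -> i %% d = j %% d -> i %% d' = j %% d'.
Proof. by move=> dv e; rewrite -(modn_dvdm i dv) e modn_dvdm. Qed.

(** An earlier left end coarsens blocks, a later right end coarsens residues; the clauses on
    supports combine these two facts. *)
Lemma supp_sys_arch : supp_sys L Dim Sup Cls.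
Proof.
split.
- by move=> p q i j pq qL; rewrite SupE // => /and4P[-> ->].
- move=> p s u i q j ps su.
  have [sL s1u uL pu [ps1 s1L]] : [/\ s <= L, 0 < s.+1 <= u, u <= L, 0 < p <= u &
      (0 < p <= s.+1) /\ s.+1 <= L].
    by split; lia.
  have dv1 : pa_ s.+1 %| Dim s by apply: pa_dvd_Dim; lia.
  have dv2 : pa_ s.+1 %| Dim u by apply: pa_dvd_Dimr.
  have dv3 : pd_ u %| pd_ s by apply: pd_dvd; lia.
  rewrite (SupE _ _ ps sL) (SupE _ _ s1u uL) (SupE _ _ pu uL) /=.
  move=> /and4P[h1 h2 /eqP h3 /eqP h4] /and4P[k1 k2 /eqP k3 /eqP k4].
  by rewrite h1 k2 h3 (blk_coarsen ps1 s1L dv1 dv2 k3) (eq_modn_dvd dv3 h4) k4 !eqxx.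
- move=> p s s' u i q q' j ps ss su.
  have [sL s'L uL ps' s1u] : [/\ s <= L, s' <= L, u <= L, 0 < p <= s' & 0 < s.+1 <= u].
    by split; lia.
  have [s'1u s1s' s1s'1 s'1L] : [/\ 0 < s'.+1 <= u, 0 < s.+1 <= s', 0 < s.+1 <= s'.+1 & s'.+1 <= L].
    by split; lia.
  have dv1 : pa_ s'.+1 %| Dim s' by apply: pa_dvd_Dim; lia.
  have dv2 : pa_ s'.+1 %| Dim u by apply: pa_dvd_Dimr.
  have dv3 : pd_ s' %| pd_ s by apply: pd_dvd; lia.
  rewrite (SupE _ _ ps sL) (SupE _ _ s1u uL) (SupE _ _ ps' s'L) (SupE _ _ s'1u uL).
  rewrite (SupE _ _ s1s' s'L) /=.
  move=> /and4P[h1 h2 /eqP h3 /eqP h4] /and4P[k1 k2 /eqP k3 /eqP k4].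
  move=> /and4P[f1 f2 /eqP f3 /eqP f4] /and4P[g1 g2 /eqP g3 /eqP g4].
  by rewrite h2 f2 k3 (blk_coarsen s1s'1 s'1L dv1 dv2 g3) -f4 (eq_modn_dvd dv3 h4) !eqxx.
- move=> p s u i j t t' ps su.
  have [sL s1u uL] : [/\ s <= L, 0 < s.+1 <= u & u <= L] by split; lia.
  rewrite !(SupE _ _ ps sL) !(SupE _ _ s1u uL) /=.
  move=> /and4P[h1 h2 /eqP h3 /eqP h4] /and4P[k1 k2 /eqP k3 /eqP k4].
  move=> /and4P[f1 f2 /eqP f3 /eqP f4] /and4P[g1 g2 /eqP g3 /eqP g4].
  by rewrite /Cls h2 k2 f3 g3 -h4 -k4 !eqxx.
- move=> p s i t t' ps sL.
  have dv1 : pa_ s.+1 %| Dim s by apply: pa_dvd_Dim; lia.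
  have ps1 : 0 < p <= s.+1 by lia.
  rewrite !(SupE _ _ ps (ltnW sL)) => /and4P[h1 h2 /eqP h3 /eqP h4].
  by rewrite h1 h2 h4 (blk_coarsen ps1 sL dv1 dv1 h3).
- move=> s u t t' j s0 su.
  have [s1u uL] : 0 < s.+1 <= u /\ u <= L by lia.
  have dv3 : pd_ u %| pd_ s by apply: pd_dvd; lia.
  rewrite !(SupE _ _ s1u uL) /= => /and4P[h1 h2 /eqP h3 /eqP h4].
  by rewrite h1 h2 h3 (eq_modn_dvd dv3 h4).
- by move=> s t sL lt; rewrite /Cls lt !eqxx.
- by move=> s t t' _ /and4P[].
- by move=> s t t' _ /and4P[h1 h2 h3 h4]; rewrite /Cls h1 h2 eq_sym h3 eq_sym h4.
- move=> s t t' t'' _ /and4P[h1 h2 /eqP h3 /eqP h4] /and4P[k1 k2 k3 k4].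
  by rewrite /Cls h1 k2 h3 h4 k3 k4.
Qed.

Lemma ltn_blk_index N a k r : 0 < a -> a %| N -> k < a -> r < N %/ a -> k * (N %/ a) + r < N.
Proof.
move=> a0 dv ka rN; rewrite -[X in _ < X](divnK dv); nia.
Qed.

Lemma blk_lt N a i : 0 < a -> a %| N -> i < N -> i %/ (N %/ a) < a.
Proof.
move=> a0 dv iN; have N0 : 0 < N %/ a by rewrite divn_gt0 // dvdn_leq //; lia.
by rewrite ltn_divLR // mulnC divnK.
Qed.

(** The offset [r] inside the block stays open: nonemptiness takes one value of it, the count of
    rows many. *)
Lemma Sup_col_witness p s t r : 0 < p <= s -> s < L -> t < Dim s ->
  r < Dim p.-1 %/ pa_ p -> r = t %[mod pd_ s] ->
  Sup p s (t %/ (Dim s %/ pa_ p) * (Dim p.-1 %/ pa_ p) + r) t.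
Proof.
move=> ps sL ts rlt rmod; rewrite SupE //; last lia.
have /pat_pos[p0 b0 c0 d0] : 0 < p <= L by lia.
have dv1 : pa_ p %| Dim p.-1 by rewrite DimE -?mulnA ?dvdn_mulr //; lia.
have dv2 : pa_ p %| Dim s by apply: pa_dvd_Dimr; lia.
rewrite ts ltn_blk_index //=; last by apply: blk_lt.
have eN : Dim p.-1 %/ pa_ p = pb_ p * pd_ p by rewrite DimE -?mulnA ?mulKn //; lia.
rewrite divnMDl ?(divn_small rlt) ?addn0 ?eqxx /=; last lia.
have /dvdnP[k ->] : pd_ s %| Dim p.-1 %/ pa_ p.
  by rewrite eN dvdn_mull // pd_dvd //; lia.
by rewrite mulnA modnMDl rmod.
Qed.

Lemma Sup_row_witness s u t r : 0 < s < u -> u <= L -> t < Dim s ->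
  r < Dim u %/ pa_ s.+1 -> r = t %[mod pd_ u] ->
  Sup s.+1 u t (t %/ (Dim s %/ pa_ s.+1) * (Dim u %/ pa_ s.+1) + r).
Proof.
move=> su uL ts rlt rmod; rewrite SupE //=; last lia.
have /pat_pos[p0 b0 c0 d0] : 0 < s.+1 <= L by lia.
have dv1 : pa_ s.+1 %| Dim s by apply: pa_dvd_Dim; lia.
have dv2 : pa_ s.+1 %| Dim u by apply: pa_dvd_Dimr; lia.
rewrite ts ltn_blk_index //=; last by apply: blk_lt.
rewrite divnMDl ?(divn_small rlt) ?addn0 ?eqxx /=; last lia.
have /dvdnP[k ->] : pd_ u %| Dim u %/ pa_ s.+1.
  have /pint_params/(_ uL)[e1 e2 _ _] : 0 < s.+1 <= u by lia.
  have <- : ncols (pint beta s.+1 u) = Dim u by apply: ncols_pint; lia.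
  by rewrite /ncols e1 e2 -mulnA mulKn // dvdn_mull.
by rewrite mulnA modnMDl rmod.
Qed.


(** * The partition of the inner indices at a cut *)

Section Blocks.
Variables p s u : nat.
Hypotheses (ps : 0 < p <= s) (su : s < u <= L).
Local Notation pl := (pint beta p s).
Local Notation pr := (pint beta s.+1 u).

Lemma pl_rows : nrows pl = Dim p.-1. Proof. by apply: nrows_pint; lia. Qed.
Lemma pl_cols : ncols pl = Dim s. Proof. by apply: ncols_pint; lia. Qed.
Lemma pr_cols : ncols pr = Dim u. Proof. by apply: ncols_pint; lia. Qed.

Lemma Sup_col_nonempty t : t < Dim s -> exists2 i, i < Dim p.-1 & Sup p s i t.
Proof.
move=> ts; have h : Sup p s (t %/ (Dim s %/ pa_ p) * (Dim p.-1 %/ pa_ p) + t %% pd_ s) t.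
  apply: Sup_col_witness => //; try lia; last by rewrite modn_mod.
  have /pat_pos[p0 b0 c0 d0] : 0 < p <= L by lia.
  have /pat_pos[_ _ _ ds0] : 0 < s <= L by lia.
  rewrite DimE -?mulnA ?mulKn //; last lia.
  apply: (leq_trans (ltn_pmod _ ds0)); apply: dvdn_leq; first by rewrite muln_gt0 b0.
  by apply/dvdn_mull/pd_dvd; lia.
eexists; last exact: h.
by case/andP: (sp_lt supp_sys_arch ps (ltnW (leq_trans (proj1 (andP su)) (proj2 (andP su)))) h).
Qed.

Lemma Sup_row_nonempty t : t < Dim s -> exists2 j, j < Dim u & Sup s.+1 u t j.
Proof.
move=> ts; have h : Sup s.+1 u t (t %/ (Dim s %/ pa_ s.+1) * (Dim u %/ pa_ s.+1) + t %% pd_ u).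
  apply: Sup_row_witness => //; try lia; last by rewrite modn_mod.
  have /pat_pos[p0 b0 c0 d0] : 0 < s.+1 <= L by lia.
  have /pat_pos[au0 _ cu0 du0] : 0 < u <= L by lia.
  apply: (leq_trans (ltn_pmod _ du0)).
  have /pint_params h : 0 < s.+1 <= u by lia.
  have {h}[|e1 e2 _ e4] := h; first lia.
  rewrite -pr_cols /ncols e1 e2 -mulnA mulKn // leq_pmull //.
  have : 0 < pa_ u * pc_ u by rewrite muln_gt0 au0.
  by rewrite -e4 muln_gt0 => /andP[].
eexists; last exact: h.
by apply: (sp_ltr supp_sys_arch _ _ h); lia.
Qed.

(** [RP] also asks for a column on the right; row [t] of the right support is nonempty, so one
    exists. *)
Lemma RPE t i : t < Dim s -> RP pl pr t i = Sup p s i t.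
Proof.
move=> ts; apply/existsP/idP => [[c /andP[]] //|h].
have [j ju hj] := Sup_row_nonempty ts; rewrite -pr_cols in ju.
by exists (Ordinal ju); rewrite -/(Sup p s i t) h.
Qed.

Lemma CPE t j : t < Dim s -> CP pl pr t j = Sup s.+1 u t j.
Proof.
move=> ts; apply/existsP/idP => [[c /andP[]] //|h].
have [i iu hi] := Sup_col_nonempty ts; rewrite -pl_rows in iu.
by exists (Ordinal iu); rewrite -/(Sup s.+1 u t j) h andbT.
Qed.

(** [U_t] is not zero, so [U_t = U_t'] yields an entry common to both; its row and column tie [t] to
    [t'] by [cl_of]. *)
Lemma inPE t t' : t < Dim s -> inP pl pr t t' = Cls s t t'.
Proof.
move=> ts; rewrite /inP pl_cols; apply/andP/idP => [[ts' /forallP h]|c].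
  have [i ip hi] := Sup_col_nonempty ts; have [j ju hj] := Sup_row_nonempty ts.
  rewrite -pl_rows in ip; rewrite -pr_cols in ju.
  have /forallP/(_ (Ordinal ju)) /= := h (Ordinal ip).
  rewrite -/(Sup p s i t) -/(Sup p s i t') -/(Sup s.+1 u t j) -/(Sup s.+1 u t' j).
  rewrite hi hj /= => /eqP/esym/andP[hi' hj'].
  exact: (cl_of supp_sys_arch ps su hi hi' hj hj').
have sL : 0 < s < L by lia.
split; first exact: (cl_lt supp_sys_arch sL (cl_sym supp_sys_arch sL c)).
apply/forallP => i; apply/forallP => j.
rewrite -/(Sup p s i t) -/(Sup p s i t') -/(Sup s.+1 u t j) -/(Sup s.+1 u t' j).
rewrite (cl_l supp_sys_arch _ ps _ c) ?(cl_r supp_sys_arch _ _ su c) ?eqxx //; lia.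
Qed.

End Blocks.

(** * Non-redundancy and the sizes of the blocks *)

Section NonRedundant.
Hypothesis nonred : ~ redundant_arch beta.
Local Notation r_ s := (rpair (pat_at beta s) (pat_at beta s.+1)).

Lemma rpairP s : 0 < s < L ->
  [/\ pb_ s.+1 * pd_ s.+1 = r_ s * pd_ s, pa_ s * pc_ s = pa_ s.+1 * r_ s,
      r_ s < pb_ s & r_ s < pc_ s.+1].
Proof.
move=> sL; have /and5P[d1 d2 /eqP e _ _] := chain sL.
have : ~~ redundant_pair (pat_at beta s) (pat_at beta s.+1).
  by apply/negP => h; apply: nonred; exists s.
rewrite /redundant_pair -ltnNge ltn_min => /andP[-> ->]; split=> //.
  by rewrite /rpair e divnK.
by rewrite /rpair [RHS]mulnC divnK.
Qed.

(** A block of length [r_s d_s] holds each residue modulo [d_s] exactly [r_s] times, so a class at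
    [s] has [r_s] elements. *)
Lemma Dim_div_pa s : 0 < s < L -> Dim s %/ pa_ s.+1 = r_ s * pd_ s.
Proof.
move=> sL; have [e _ _ _] := rpairP sL.
have /pat_pos[p0 b0 c0 d0] : 0 < s.+1 <= L by lia.
by rewrite (@DimE s.+1) -?mulnA ?mulKn //; lia.
Qed.

(** Telescoping: [r_s d_s <= b_s d_s = r_(s-1) d_(s-1)], and so on down to [b_p d_p]. *)
Lemma rank_le_rows p s : 0 < p <= s -> s < L -> r_ s * pd_ s <= pb_ p * pd_ p.
Proof.
case/andP=> p0 ps; rewrite -(subnKC ps); elim: (s - p) => [|k IH] kL.
  rewrite addn0 leq_mul2r; have /rpairP[_ _ h _] : 0 < p < L by lia.
  by rewrite (ltnW h) orbT.
have le : r_ (p + k) * pd_ (p + k) <= pb_ p * pd_ p by apply: IH; lia.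
apply: leq_trans le; have /rpairP[<- _ _ _] : 0 < p + k < L by lia.
rewrite addnS leq_mul2r; have /rpairP[_ _ h _] : 0 < (p + k).+1 < L by lia.
by rewrite (ltnW h) orbT.
Qed.

(** Telescoping: [a_(s+1) r_s <= a_(s+1) c_(s+1) = a_(s+2) r_(s+1)], and so on up to [a_u c_u]. *)
Lemma rank_le_cols s u : 0 < s < u -> u <= L -> pa_ s.+1 * r_ s <= pa_ u * pc_ u.
Proof.
case/andP=> s0 su; rewrite -(subnKC su); elim: (u - s.+1) => [|k IH] kL.
  rewrite addn0 leq_mul2l; have /rpairP[_ _ _ h] : 0 < s < L by lia.
  by rewrite (ltnW h) orbT.
apply: leq_trans (IH _) _; first lia.
have /rpairP[_ -> _ _] : 0 < s.+1 + k < L by lia.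
rewrite addnS leq_mul2l; have /rpairP[_ _ _ h] : 0 < s.+1 + k < L by lia.
by rewrite (ltnW h) orbT.
Qed.

Lemma leq_card_ord n m (P Q : pred nat) (f : nat -> nat) :
  (forall k, k < n -> P k -> (f k < m) && Q (f k)) ->
  (forall k k', k < n -> k' < n -> P k -> P k' -> f k = f k' -> k = k') ->
  #|[pred q : 'I_n | P q]| <= #|[pred r : 'I_m | Q r]|.
Proof.
move=> fP fI; rewrite !cardE.
rewrite -(size_map (fun q : 'I_n => f q)) -(size_map (@nat_of_ord m)).
apply: uniq_leq_size => [|x /mapP[q]].
  rewrite map_inj_in_uniq ?enum_uniq // => q q'; rewrite !mem_enum !inE => Pq Pq' e.
  by apply: val_inj; apply: fI e.
rewrite mem_enum inE => Pq ->; have /andP[fm Qf] := fP q (ltn_ord q) Pq.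
by apply/mapP; exists (Ordinal fm); rewrite // mem_enum inE.
Qed.

Lemma card_Cls_rows p s t : 0 < p <= s -> s < L -> t < Dim s ->
  #|[pred q : 'I_(Dim s) | Cls s t q]| <= #|[pred r : 'I_(Dim p.-1) | Sup p s r t]|.
Proof.
move=> ps sL ts; pose g := Dim s %/ pa_ s.+1.
have s0L : 0 < s < L by lia.
have eg : g = r_ s * pd_ s by apply: Dim_div_pa.
have /pat_pos[p0 b0 c0 d0] : 0 < p <= L by lia.
have g0 : 0 < g.
  have /pat_pos[a1 b1 c1 d1] : 0 < s.+1 <= L by lia.
  by rewrite /g (@DimE s.+1) -?mulnA ?mulKn ?muln_gt0 ?b1 //; lia.
(* The class is copied into the block of rows with its offsets modulo [g]. Residues modulo [d_s]
   survive because [d_s] divides [g], and the map is injective because members of a class share the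
   quotient by [g]. *)
pose f t' := t %/ (Dim s %/ pa_ p) * (Dim p.-1 %/ pa_ p) + t' %% g.
apply: (@leq_card_ord _ _ (Cls s t) (fun r => Sup p s r t) f) => [k ks|k k' ks ks'].
  move=> /and4P[_ _ _ /eqP km]; have h : Sup p s (f k) t.
    apply: Sup_col_witness => //.
      apply: leq_trans (ltn_pmod _ g0) _.
      rewrite eg DimE -?mulnA ?mulKn //; last lia.
      exact: rank_le_rows.
    by rewrite modn_dvdm ?km // eg dvdn_mull.
  by rewrite h andbT; case/andP: (sp_lt supp_sys_arch ps (ltnW sL) h).
move=> /and4P[_ _ /eqP e1 _] /and4P[_ _ /eqP e2 _] /addnI e.
by rewrite (divn_eq k g) (divn_eq k' g) e -/g -e1 e2.
Qed.

Lemma card_Cls_cols s u t : 0 < s < u -> u <= L -> t < Dim s ->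
  #|[pred q : 'I_(Dim s) | Cls s t q]| <= #|[pred r : 'I_(Dim u) | Sup s.+1 u t r]|.
Proof.
move=> su uL ts; pose g := Dim s %/ pa_ s.+1.
have s0L : 0 < s < L by lia.
have eg : g = r_ s * pd_ s by apply: Dim_div_pa.
have /pat_pos[a1 b1 c1 d1] : 0 < s.+1 <= L by lia.
have /pat_pos[_ _ _ ds] : 0 < s <= L by lia.
have /pat_pos[_ _ _ du] : 0 < u <= L by lia.
have g0 : 0 < g.
  by rewrite /g (@DimE s.+1) -?mulnA ?mulKn ?muln_gt0 ?b1 //; lia.
(* Columns are compared modulo [d_u], not [d_s], so offsets cannot be kept. What is kept is the rank
   [h t' < r_s] of a member within its class; it is multiplied by [d_u] and the residue of [t] is
   added. *)
pose h k := k %% g %/ pd_ s.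
have hr k : h k < r_ s by rewrite ltn_divLR // -eg ltn_pmod.
have hu : r_ s * pd_ u <= Dim u %/ pa_ s.+1.
  have -> : Dim u = pa_ u * pc_ u * pd_ u by case: (u) su => // /andP[]; lia.
  by rewrite leq_divRL // mulnC mulnA leq_mul2r rank_le_cols ?orbT.
pose f t' := t %/ g * (Dim u %/ pa_ s.+1) + (h t' * pd_ u + t %% pd_ u).
apply: (@leq_card_ord _ _ (Cls s t) (fun r => Sup s.+1 u t r) f) => [k ks|k k' ks ks'].
  move=> /and4P[_ _ _ /eqP km]; have hS : Sup s.+1 u t (f k).
    apply: Sup_row_witness => //; last by rewrite modnMDl modn_mod.
    apply: leq_trans hu; apply: (@leq_trans ((h k).+1 * pd_ u)).
      by rewrite mulSn addnC ltn_add2r ltn_pmod.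
    by rewrite leq_mul2r hr orbT.
  by rewrite hS andbT; apply: (sp_ltr supp_sys_arch _ _ hS); lia.
move=> /and4P[_ _ /eqP e1 /eqP m1] /and4P[_ _ /eqP e2 /eqP m2] /addnI/addIn/eqP.
rewrite eqn_pmul2r // => /eqP e.
have modE j : t %% pd_ s = j %% pd_ s -> j %% g = h j * pd_ s + t %% pd_ s.
  by move=> ->; rewrite -(@modn_dvdm g j (pd_ s)) ?eg ?dvdn_mull // -?eg -divn_eq.
by rewrite (divn_eq k g) (divn_eq k' g) !modE // e -/g -e1 e2.
Qed.

End NonRedundant.
End Patterns.

(** * QR factorization and best low rank approximation *)

Section LowRank.
Variable R : rcfType.
Local Notation C := R[i].
Local Open Scope sesquilinear_scope.

(** Gram-Schmidt on the rows, that is QR of the transpose. [schmidt] returns orthonormal rows even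
    if those of [A] are dependent, so any rank is allowed; row [i] of [A] lies in the span of the
    Schmidt rows up to [i], whence the triangular shape. *)
Lemma qr_mx r m (A : 'M[C]_(r, m)) : (r <= m)%N ->
  exists (V : 'M[C]_(r, m)) (B : 'M[C]_r), [/\ V \is unitarymx, A = B *m V &
    forall i j : 'I_r, (i < j)%N -> B i j = 0].
Proof.
move=> rm; pose V := schmidt A; have uV : V \is unitarymx by apply: schmidt_unitarymx.
exists V, (A *m V^t*); split=> //.
  have /submxP[B eB] := schmidt_sub A.
  by rewrite {2}eB -/V mulmxtVK // -eB.
move=> i j ij.
have h : (row i A <= kermx ((row j V)^t*))%MS.
  apply: submx_trans (row_schmidt_sub A i) _; apply/sumsmx_subP => k ki.
  rewrite genmxE; apply/sub_kermxP.
  have /row_unitarymxP/(_ k j) := uV; rewrite dotmxE -/V.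
  have -> : (k == j) = false by rewrite -val_eqE /=; lia.
  by move=> e; apply/matrixP => a b; rewrite !ord1 e mxE.
move/sub_kermxP/matrixP/(_ 0 0): h; rewrite !mxE => e; rewrite -[RHS]e.
by apply: eq_bigr => k _; rewrite !mxE.
Qed.

Definition mx_frob2 m n (X : 'M[C]_(m, n)) : R := \sum_i \sum_j abs2 (X i j).

Lemma mx_frob2_ge0 m n (X : 'M[C]_(m, n)) : 0 <= mx_frob2 X.
Proof. by rewrite !sumr_ge0 // => i _; rewrite sumr_ge0 // => j _; apply: abs2_ge0. Qed.

Lemma mx_frob2E m n (X : 'M[C]_(m, n)) : (mx_frob2 X)%:C%C = \tr (X *m X^t*).
Proof.
rewrite /mx_frob2 rmorph_sum; apply: eq_bigr => i _; rewrite rmorph_sum mxE.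
by apply: eq_bigr => j _; rewrite !mxE /= abs2C mulrC.
Qed.

Lemma trC_mul m n p (X : 'M[C]_(m, n)) (Y : 'M[C]_(n, p)) : (X *m Y)^t* = Y^t* *m X^t*.
Proof. by rewrite trmx_mul map_mxM. Qed.

Lemma trCB m n (X Y : 'M[C]_(m, n)) : (X - Y)^t* = X^t* - Y^t*.
Proof. by apply/matrixP => i j; rewrite !mxE rmorphB. Qed.

Lemma mx_frob2_isometry r m n (V : 'M[C]_(r, m)) (M : 'M[C]_(m, n)) (Y : 'M[C]_(r, n)) :
  V \is unitarymx ->
  mx_frob2 (M - V^t* *m Y) = mx_frob2 M - mx_frob2 (V *m M) + mx_frob2 (V *m M - Y).
Proof.
move=> /unitarymxP VV; apply: complexI; rewrite rmorphD rmorphB /= !mx_frob2E.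
rewrite !trCB !trC_mul trmxCK !mulmxBl !mulmxBr !raddfB /=.
have -> : \tr (V^t* *m Y *m (Y^t* *m V)) = \tr (Y *m Y^t*).
  by rewrite mulmxA mxtrace_mulC -!mulmxA [V *m _]mulmxA VV mul1mx.
have -> : \tr (M *m (Y^t* *m V)) = \tr (V *m M *m Y^t*).
  by rewrite mulmxA mxtrace_mulC mulmxA.
have -> : \tr (V^t* *m Y *m M^t*) = \tr (Y *m (M^t* *m V^t*)).
  by rewrite -mulmxA mxtrace_mulC mulmxA.
by ring.
Qed.

(** The threshold [tau] between the [r] largest values and the others takes the place of sorting the
    eigenvalues. *)
Lemma top_set (m r : nat) (l : 'I_m -> R) : (r <= m)%N -> (forall i, 0 <= l i) ->
  exists (T : {set 'I_m}) (tau : R), [/\ #|T| = r,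
    forall i, i \in T -> tau <= l i & forall i, i \notin T -> l i <= tau].
Proof.
move=> + l0; elim: r => [_|r IH rm].
  (* For the empty set [tau] must dominate all values; their sum does, as they are nonnegative. *)
  exists finset.set0, (\sum_i l i); split=> [|i|i _]; rewrite ?cards0 ?inE //.
  by rewrite (bigD1 i) //= lerDl sumr_ge0.
have [T [tau [cT hT hT']]] := IH (ltnW rm).
have [i0 i0T] : exists i0, i0 \notin T.
  apply/existsP; apply: contraT; rewrite negb_exists => /forallP h.
  have eT : T = finset.setT by apply/finset.setP => i; rewrite inE; have := h i; rewrite negbK.
  by move: cT rm; rewrite eT cardsT card_ord => ->; rewrite ltnn.
pose i1 := [arg max_(i > i0 | i \notin T) l i]%O.
have [i1T i1max] : i1 \notin T /\ forall j, j \notin T -> l j <= l i1.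
  by rewrite /i1; case: Order.TotalTheory.arg_maxP => // i ? h; split=> // j /h.
exists (i1 |: T)%SET, (l i1); split.
- by rewrite cardsU1 i1T cT.
- by move=> i; rewrite !inE => /predU1P[->//|/hT]; apply: le_trans; apply: hT'.
- by move=> i; rewrite !inE negb_or => /andP[_ /i1max].
Qed.

(* Eckart-Young: among the products [V^* Y] with [V] of orthonormal rows the
   best error is [mx_frob2 M - mx_frob2 (V M)], and [mx_frob2 (V M)] is a sum of eigenvalues of
   [M M^*] with weights in [0, 1] of total [r]. *)
Lemma best_rank r m n (M : 'M[C]_(m, n)) : (r <= m)%N ->
  exists (H : 'M[C]_(m, r)) (K : 'M[C]_(r, n)),
    forall (H' : 'M[C]_(m, r)) (K' : 'M[C]_(r, n)),
    mx_frob2 (M - H *m K) <= mx_frob2 (M - H' *m K').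
Proof.
move=> rm; pose G := M *m M^t*; pose P := spectralmx G.
have uP : P \is unitarymx by apply: spectral_unitarymx.
have PP : P *m P^t* = 1%:M by apply/unitarymxP.
have PP' : P^t* *m P = 1%:M by apply: mulmx1C.
have nG : G \is normalmx by apply/normalmxP; rewrite /G trC_mul trmxCK.
pose sp := spectral_diag G.
have eG : G = P^t* *m diag_mx sp *m P.
  by rewrite -invmx_unitary //; apply/orthomx_spectralP.
pose l i : R := \sum_j abs2 ((P *m M) i j).
have spE i : sp 0 i = (l i)%:C%C.
  have : (P *m G *m P^t*) i i = sp 0 i.
    rewrite eG !mulmxA PP mul1mx -mulmxA PP mulmx1.
    by rewrite mxE eqxx mulr1n.
  move=> <-; rewrite /G !mulmxA -mulmxA -trC_mul mxE /l rmorph_sum.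
  by apply: eq_bigr => j _; rewrite /= abs2C [RHS]mulrC !mxE.
have l0 i : 0 <= l i by rewrite sumr_ge0 // => j _; apply: abs2_ge0.
(* In the eigenbasis of [M M^*] the weight of the eigenvalue [l i] is the squared norm of column [i]
   of [V P^*]. *)
have nmV (V : 'M[C]_(r, m)) : mx_frob2 (V *m M) = \sum_i l i * \sum_k abs2 ((V *m P^t*) k i).
  apply: complexI; rewrite mx_frob2E trC_mul !mulmxA -[V *m M *m _]mulmxA -/G eG !mulmxA.
  set W := V *m P^t*; rewrite -mulmxA.
  have -> : P *m V^t* = W^t* by rewrite /W trC_mul trmxCK.
  rewrite mxtrace_mulC mulmxA /mxtrace rmorph_sum; apply: eq_bigr => i _.
  rewrite rmorphM /= -spE rmorph_sum mul_mx_diag mxE mulrC mxE; congr (_ * _).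
  by apply: eq_bigr => k _; rewrite !mxE /= abs2C.
have [T [tau [cT hT hT']]] := top_set rm l0.
have nmV_le (V : 'M[C]_(r, m)) : V \is unitarymx -> mx_frob2 (V *m M) <= \sum_(i in T) l i.
  move=> uV; rewrite nmV; set W := V *m P^t*.
  have WW : W *m W^t* = 1%:M.
    by rewrite /W trC_mul trmxCK mulmxA -(mulmxA V) PP' mulmx1; apply/unitarymxP.
  clearbody W; pose w i : R := \sum_k abs2 (W k i).
  have w0 i : 0 <= w i by rewrite sumr_ge0 // => j _; apply: abs2_ge0.
  have wE i : (w i)%:C%C = (W^t* *m W) i i.
    by rewrite /w rmorph_sum mxE; apply: eq_bigr => k _; rewrite !mxE /= abs2C.
  (* [W^* W] is an orthogonal projection, so its diagonal entry [w i] is the squared norm of its row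
     [i] and at least [w i ^+ 2]. *)
  have w1 i : w i <= 1.
    have : w i ^+ 2 <= w i.
      have -> : w i ^+ 2 = abs2 ((W^t* *m W) i i).
        by rewrite -wE /abs2 /= expr0n addr0.
      have -> : w i = \sum_j abs2 ((W^t* *m W) i j).
        have idem : W^t* *m W = (W^t* *m W) *m (W^t* *m W)^t*.
          by rewrite trC_mul trmxCK mulmxA -[_ *m W *m _]mulmxA WW mulmx1.
        apply: complexI; rewrite wE {1}idem mxE rmorph_sum.
        by apply: eq_bigr => j _; rewrite /= abs2C [RHS]mulrC !mxE.
      by rewrite [leRHS](bigD1 i) //= lerDl sumr_ge0 // => j _; apply: abs2_ge0.
    have := w0 i; nra.
  have wr : \sum_i w i = r%:R.
    apply: complexI; rewrite rmorph_sum rmorph_nat; transitivity (\tr (W^t* *m W)).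
      by apply: eq_bigr => i _; rewrite -wE.
    by rewrite mxtrace_mulC WW mxtrace1.
  (* Both sums are shifted by [tau], whose total weight is [r] in each. The terms then compare one
     by one: [l i - tau] is nonnegative on [T], where weights are at most 1, and nonpositive off
     [T]. *)
  have -> : \sum_i l i * w i = \sum_i (l i - tau) * w i + tau * r%:R.
    by rewrite -wr mulr_sumr -big_split /=; apply: eq_bigr => i _; rewrite -mulrDl subrK.
  have -> : \sum_(i in T) l i = \sum_(i in T) (l i - tau) + tau * r%:R.
    by rewrite sumrB sumr_const cT mulr_natr subrK.
  rewrite lerD2r (bigID (mem T)) /= -[leRHS]addr0; apply: lerD.
    by apply: ler_sum => i /hT h; have := w1 i; have := w0 i; nra.
  by apply: sumr_le0 => i /hT' h; have := w0 i; nra.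
pose c (k : 'I_r) : 'I_m := enum_val (cast_ord (esym cT) k).
pose V0 := rowsub c P.
have cI : injective c by move=> k k' /enum_val_inj/cast_ord_inj.
have uV0 : V0 \is unitarymx.
  apply/unitarymxP/matrixP => a b; rewrite !mxE.
  have /matrixP/(_ (c a) (c b)) := PP; rewrite !mxE (inj_eq cI) => <-.
  by apply: eq_bigr => k _; rewrite !mxE.
have nmV0 : mx_frob2 (V0 *m M) = \sum_(i in T) l i.
  rewrite big_enum_val /mx_frob2 (reindex (cast_ord (esym cT))) /=; last first.
    by exists (cast_ord cT) => x _; rewrite ?cast_ordK ?cast_ordKV.
  apply: eq_bigr => k _; apply: eq_bigr => j _; congr abs2; rewrite !mxE.
  by apply: eq_bigr => a _; rewrite !mxE.
exists (V0^t*), (V0 *m M) => H' K'.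
rewrite mx_frob2_isometry // subrr nmV0.
(* QR of the adjoint of [H'] brings every competitor to the form [V^* Y] with [V] of orthonormal
   rows. *)
have [V [B [uV eH _]]] := qr_mx (H'^t*) rm.
have -> : H' = V^t* *m B^t* by rewrite -trC_mul -eH trmxCK.
rewrite -mulmxA mx_frob2_isometry //.
have -> : mx_frob2 (0 : 'M[C]_(r, n)) = 0.
  by apply: big1 => i _; apply: big1 => j _; rewrite mxE /abs2 /= expr0n addr0.
have := nmV_le V uV; have := mx_frob2_ge0 (V *m M - B^t* *m K'); lra.
Qed.

End LowRank.

(** * Blocks *)

Section Blocks.
Variable R : rcfType.
Local Notation C := R[i].
Local Notation ix n P := [pred r : 'I_n | P (nat_of_ord r)].

Lemma sum_enum_val (V : nmodType) n (P : pred nat) (F : 'I_n -> V) :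
  \sum_(r < n | P r) F r = \sum_(i < #|ix n P|) F (enum_val i).
Proof. by rewrite -(big_enum_val (A := ix n P) F). Qed.

Lemma enum_val_ex n (P : pred nat) r : (r < n)%N -> P r ->
  exists i : 'I_#|ix n P|, r = nat_of_ord (enum_val i).
Proof.
move=> rn Pr; have rA : Ordinal rn \in ix n P by rewrite inE.
by exists (enum_rank_in rA (Ordinal rn)); rewrite enum_rankK_in.
Qed.

(** Enumerations are increasing, so a matrix triangular in positions is triangular in the natural
    order of indices, as [uptri] asks. *)
Lemma enum_val_lt n (P : pred nat) (i j : 'I_#|ix n P|) :
  (enum_val i < enum_val j)%N -> (i < j)%N.
Proof.
move=> lt; rewrite ltnNge; apply/negP; rewrite leq_eqVlt => /predU1P[e|ji].
  by move: lt; rewrite (val_inj e) ltnn.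
have srt : sorted ltn (map val (enum (ix n P))).
  have /= -> : enum (ix n P) = filter (ix n P) (enum 'I_n) by rewrite enumT.
  rewrite sorted_map; apply: sorted_filter; first by move=> ? ? ?; apply: ltn_trans.
  by rewrite -sorted_map val_enum_ord iota_ltn_sorted.
have := @sorted_ltn_nth _ ltn ltn_trans 0%N _ srt j i.
rewrite !inE !size_map -!cardE !ltn_ord => /(_ isT isT ji).
rewrite !(nth_map (enum_val i)) -?cardE ?ltn_ord // -!enum_val_nth /=.
by rewrite ltnNge (ltnW lt).
Qed.

Definition sub_mx n k (P Q : pred nat) (X : mat R) : 'M[C]_(#|ix n P|, #|ix k Q|) :=
  \matrix_(i < #|ix n P|, j < #|ix k Q|) X (enum_val i) (enum_val j).

Definition emb_mx n k (P Q : pred nat) (M : 'M[C]_(#|ix n P|, #|ix k Q|)) : mat R :=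
  fun r q => match [pick i : 'I_#|ix n P| | nat_of_ord (enum_val i) == r],
                   [pick j : 'I_#|ix k Q| | nat_of_ord (enum_val j) == q] with
             | Some i, Some j => M i j | _, _ => 0 end.

Lemma emb_mxE n k (P Q : pred nat) (M : 'M[C]_(#|ix n P|, #|ix k Q|))
    (i : 'I_#|ix n P|) (j : 'I_#|ix k Q|) :
  emb_mx M (enum_val i) (enum_val j) = M i j.
Proof.
rewrite /emb_mx; case: pickP => [i'|/(_ i)]; last by rewrite eqxx.
rewrite val_eqE => /eqP/enum_val_inj->.
case: pickP => [j'|/(_ j)]; last by rewrite eqxx.
by rewrite val_eqE => /eqP/enum_val_inj->.
Qed.

Lemma block_qr n k (rows cls : pred nat) (X : mat R) :
  (#|ix k cls| <= #|ix n rows|)%N ->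
  exists Q Rm : mat R, [/\ ortho_cols rows n cls k Q, uptri cls Rm &
    forall r q, (r < n)%N -> (q < k)%N -> rows r -> cls q ->
      X r q = \sum_(t < k | cls t) Q r t * Rm t q].
Proof.
move=> le; have [V [B [/unitarymxP/matrixP uV eX low]]] := qr_mx (sub_mx n k rows cls X)^T le.
exists (emb_mx V^T), (emb_mx B^T); split.
- move=> p q pk qk cp cq; have [i ->] := enum_val_ex pk cp; have [j ->] := enum_val_ex qk cq.
  rewrite sum_enum_val; have := uV j i; rewrite !mxE eq_sym val_eqE (inj_eq enum_val_inj) => <-.
  by apply: eq_bigr => a _; rewrite !emb_mxE !mxE mulrC.
- move=> p q _ _ qp; rewrite /emb_mx; case: pickP => // i /eqP ei; case: pickP => // j /eqP ej.
  by rewrite mxE low //; apply: enum_val_lt; rewrite ei ej.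
move=> r q rn qk Pr Pq; have [i ->] := enum_val_ex rn Pr; have [j ->] := enum_val_ex qk Pq.
have /matrixP/(_ j i) := eX; rewrite !mxE => ->; rewrite sum_enum_val.
by apply: eq_bigr => a _; rewrite !emb_mxE !mxE mulrC.
Qed.

Definition berr n m k (rows cols cls : pred nat) (M H K : mat R) : R :=
  \sum_(r < n | rows r) \sum_(c < m | cols c)
     abs2 (M r c - \sum_(q < k | cls q) H r q * K q c).

Lemma berrE n m k rows cols cls M H K : berr n m k rows cols cls M H K
  = mx_frob2 (sub_mx n m rows cols M - sub_mx n k rows cls H *m sub_mx k m cls cols K).
Proof.
rewrite /berr sum_enum_val; apply: eq_bigr => i _.
rewrite sum_enum_val; apply: eq_bigr => j _; rewrite sum_enum_val !mxE.
by congr (abs2 (_ - _)); apply: eq_bigr => a _; rewrite !mxE.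
Qed.

Lemma emb_mxK n k P Q (M : 'M[C]_(#|ix n P|, #|ix k Q|)) : sub_mx n k P Q (emb_mx M) = M.
Proof. by apply/matrixP => i j; rewrite mxE emb_mxE. Qed.

Lemma block_best n m k (rows cols cls : pred nat) (M : mat R) :
  (#|ix k cls| <= #|ix n rows|)%N ->
  exists H K : mat R, forall H' K',
    berr n m k rows cols cls M H K <= berr n m k rows cols cls M H' K'.
Proof.
move=> le; have [H [K best]] := best_rank (sub_mx n m rows cols M) le.
exists (emb_mx H), (emb_mx K) => H' K'; rewrite !berrE !emb_mxK; exact: best.
Qed.

(* [Sa] and [Sb] are the supports of the two factors, [c] the class relation of
   their inner indices. *)
Variables (n m k : nat) (Sa Sb : nat -> nat -> bool) (c : nat -> nat -> bool).
Hypothesis ca : forall r t t', c t t' -> Sa r t = Sa r t'.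
Hypothesis cb : forall j t t', c t t' -> Sb t j = Sb t' j.
Hypothesis crefl : forall t, (t < k)%N -> c t t.
Hypothesis csym : forall t t', c t t' -> c t' t.
Hypothesis ctrans : forall t t' t'', c t t' -> c t' t'' -> c t t''.
Hypothesis clt : forall t t', c t t' -> (t < k)%N.
Hypothesis Sa_lt : forall r t, Sa r t -> (r < n)%N && (t < k)%N.
Hypothesis Sb_lt : forall t j, Sb t j -> (t < k)%N && (j < m)%N.
Hypothesis cof : forall r j t t', Sa r t -> Sa r t' -> Sb t j -> Sb t' j -> c t t'.

Lemma ortho_block_transfer (X Y X' Y' : mat R) :
  supp_in Sa X -> supp_in Sb Y -> supp_in Sa X' -> supp_in Sb Y' ->
  (forall i, (i < k)%N -> exists Q Rm : mat R,
    [/\ ortho_cols (fun r => Sa r i) n (c i) k Q,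
        (forall r q, Sa r i -> c i q -> X r q = \sum_(t < k | c i t) Q r t * Rm t q),
        (forall r q, Sa r i -> c i q -> X' r q = Q r q) &
        (forall q j, c i q -> Sb i j -> Y' q j = \sum_(t < k | c i t) Rm q t * Y t j)]) ->
  exists T : mat R, [/\ supp_in c T,
    forall t t', c t t' -> mmul n (madj X') X' t t' = (t == t')%:R,
    X = mmul k X' T & Y' = mmul k T Y].
Proof.
move=> sX sY sX' sY' blk.
have oX t t' : c t t' -> mmul n (madj X') X' t t' = (t == t')%:R.
  move=> ct; have tk := clt ct; have [Q [Rm [oQ _ eQ _]]] := blk t tk.
  have t'k := clt (csym ct).
  rewrite -(oQ t t') ?crefl // [RHS]big_mkcond; apply: eq_bigr => r _ /=.
  case: ifPn => h; first by rewrite /madj !eQ ?crefl.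
  by rewrite /madj sX' // conjc0 mul0r.
have XE i (ik : (i < k)%N) : exists Rm : mat R,
    (forall r q, c i q -> X r q = \sum_(t < k | c i t) X' r t * Rm t q) /\
    (forall q j, c i q -> Sb i j -> Y' q j = \sum_(t < k | c i t) Rm q t * Y t j).
  have [Q [Rm [_ eX eQ eY]]] := blk i ik; exists Rm; split=> // r q' cq.
  case: (boolP (Sa r i)) => h.
    by rewrite eX //; apply: eq_bigr => t ct; rewrite eQ.
  rewrite sX -?(ca _ cq) // big1 // => t ct; rewrite sX' ?mul0r //.
  by rewrite -(ca _ ct).
(* Inside a class [X'^* X = Q^* Q R = R], so this single matrix recovers the triangular factors of
   all blocks, whichever member [i] describes a block. *)
pose T := mrestr c (mmul n (madj X') X).
have TE i (Rm : mat R) : (forall r q, c i q -> X r q = \sum_(t < k | c i t) X' r t * Rm t q) ->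
    forall t q, c i t -> c i q -> T t q = Rm t q.
  move=> eX t q ct cq; rewrite /T /mrestr (ctrans (csym ct) cq) /mmul.
  under eq_bigr do rewrite eX // mulr_sumr.
  rewrite exchange_big /=; have tk := clt (csym ct).
  have GE t' : c i t' -> \sum_(r < n) madj X' t r * (X' r t' * Rm t' q) = (t == t')%:R * Rm t' q.
    move=> ct'; rewrite -(oX _ _ (ctrans (csym ct) ct')) /mmul mulr_suml.
    by apply: eq_bigr => r _; rewrite mulrA.
  rewrite (bigD1 (Ordinal tk)) //= GE // eqxx mul1r big1 ?addr0 // => t' /andP[ct' ne].
  rewrite GE //; have -> : (t == t') = false by apply: contraNF ne => /eqP e; apply/eqP/val_inj.
  by rewrite mul0r.
have sT : supp_in c T by apply: supp_mrestr.
exists T; split=> //.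
  apply: matP => r q; case: (ltnP q k) => qk; last first.
    rewrite sX; last by apply/negP => /Sa_lt; lia.
    rewrite /mmul big1 // => t _; rewrite sT ?mulr0 //.
    by apply/negP => /csym/clt; lia.
  have [Rm [eX _]] := XE q qk; rewrite eX ?crefl // [LHS]big_mkcond.
  apply: eq_bigr => t _ /=; case: ifPn => ct; first by rewrite (TE q Rm) ?crefl.
  by rewrite sT ?mulr0 //; apply: contra ct => /csym.
apply: matP => q j; case: (boolP (Sb q j)) => h; last first.
  rewrite sY' // /mmul big1 // => t _; case: (boolP (c q t)) => ct.
    by rewrite sY ?mulr0 // -(cb _ ct).
  by rewrite sT ?mul0r.
have /andP[qk _] := Sb_lt h.
have [Rm [eX eY]] := XE q qk; rewrite eY ?crefl // [LHS]big_mkcond.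
apply: eq_bigr => t _ /=; case: ifPn => ct; first by rewrite (TE q Rm) ?crefl.
by rewrite sT ?mul0r.
Qed.

(** The block conditions are stated for every index, but one choice must serve a whole class; it is
    made at the least member. *)
Definition rep i := find (c i) (iota 0 k).

Lemma rep_cls i : (i < k)%N -> c i (rep i).
Proof.
move=> ik; have h : has (c i) (iota 0 k) by apply/hasP; exists i; rewrite ?mem_iota ?crefl.
have := nth_find 0%N h; rewrite nth_iota //.
by move: h; rewrite has_find size_iota.
Qed.

Lemma eq_rep i i' : c i i' -> rep i = rep i'.
Proof.
move=> ci; apply: eq_find => t; apply/idP/idP; apply: ctrans => //; exact: csym.
Qed.

Lemma cls_rep i : (i < k)%N -> c (rep i) =1 c i.
Proof.
by move=> /rep_cls ci t; apply/idP/idP; apply: ctrans => //; apply: csym.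
Qed.

Lemma ortho_block_exists (X Y : mat R) :
  (forall i, (i < k)%N -> (#|ix k (c i)| <= #|ix n (fun r => Sa r i)|)%N) ->
  exists X' Y' : mat R, [/\ supp_in Sa X', supp_in Sb Y' &
  forall i, (i < k)%N -> exists Q Rm : mat R,
    [/\ ortho_cols (fun r => Sa r i) n (c i) k Q, uptri (c i) Rm,
        (forall r q, Sa r i -> c i q -> X r q = \sum_(t < k | c i t) Q r t * Rm t q),
        (forall r q, Sa r i -> c i q -> X' r q = Q r q) &
        (forall q j, c i q -> Sb i j -> Y' q j = \sum_(t < k | c i t) Rm q t * Y t j)]].
Proof.
move=> le.
have /choice[Q0 hQ] : forall i, exists QR : mat R * mat R, (i < k)%N ->
    [/\ ortho_cols (fun r => Sa r i) n (c i) k QR.1, uptri (c i) QR.2 &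
    forall r q, (r < n)%N -> (q < k)%N -> Sa r i -> c i q ->
      X r q = \sum_(t < k | c i t) QR.1 r t * QR.2 t q].
  move=> i; case: (ltnP i k) => ik; last by exists (mat0 R, mat0 R) => //; lia.
  by have [Q [Rm h]] := block_qr X (le i ik); exists (Q, Rm).
pose X' := mrestr Sa (fun r q => (Q0 (rep q)).1 r q).
pose Y' := mrestr Sb (fun q j => \sum_(t < k | c q t) (Q0 (rep q)).2 q t * Y t j).
exists X', Y'; split; [exact: supp_mrestr|exact: supp_mrestr|].
move=> i ik; exists (Q0 (rep i)).1, (Q0 (rep i)).2.
have ri := rep_cls ik; have rk := clt (csym ri); have rc := cls_rep ik.
have rS r : Sa r (rep i) = Sa r i by rewrite -(ca _ ri).
have [h1 h2 h3] := hQ _ rk; split.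
- move=> p q pk qk cp cq; rewrite -(h1 p q) ?rc //.
  by apply: eq_bigl => r; rewrite rS.
- by move=> p q cp cq; apply: h2; rewrite rc.
- move=> r q Sr cq; rewrite h3 ?rc ?rS //; first exact: eq_bigl.
    by case/andP: (Sa_lt Sr).
  exact: clt (csym cq).
- by move=> r q Sr cq; rewrite /X' /mrestr -(ca _ cq) Sr (eq_rep cq).
move=> q j cq Sj; rewrite /Y' /mrestr -(cb _ cq) Sj (eq_rep cq).
by apply: eq_bigl => t; apply/idP/idP; apply: ctrans => //; apply: csym.
Qed.

Lemma best_block_exists (M : mat R) :
  (forall i, (i < k)%N -> (#|ix k (c i)| <= #|ix n (fun r => Sa r i)|)%N) ->
  exists X Y : mat R, [/\ supp_in Sa X, supp_in Sb Y &
  forall i, (i < k)%N -> forall H K : mat R,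
    berr n m k (fun r => Sa r i) (Sb i) (c i) M X Y
      <= berr n m k (fun r => Sa r i) (Sb i) (c i) M H K].
Proof.
move=> le.
have /choice[Q0 hQ] : forall i, exists QR : mat R * mat R, (i < k)%N ->
    forall H K : mat R, berr n m k (fun r => Sa r i) (Sb i) (c i) M QR.1 QR.2
      <= berr n m k (fun r => Sa r i) (Sb i) (c i) M H K.
  move=> i; case: (ltnP i k) => ik; last by exists (mat0 R, mat0 R) => //; lia.
  by have [Q [Rm h]] := block_best m (Sb i) M (le i ik); exists (Q, Rm).
exists (mrestr Sa (fun r q => (Q0 (rep q)).1 r q)).
exists (mrestr Sb (fun q j => (Q0 (rep q)).2 q j)).
split; [exact: supp_mrestr|exact: supp_mrestr|] => i ik H K.
have ri := rep_cls ik; have rk := clt (csym ri); have rc := cls_rep ik.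
have eB H' K' : berr n m k (fun r => Sa r (rep i)) (Sb (rep i)) (c (rep i)) M H' K'
    = berr n m k (fun r => Sa r i) (Sb i) (c i) M H' K'.
  rewrite /berr; apply: eq_big => [r|r _]; first by rewrite (ca _ ri).
  apply: eq_big => [j|j _]; first by rewrite (cb _ ri).
  by congr (abs2 (_ - _)); apply: eq_bigl.
have := hQ _ rk H K; rewrite !eB; apply: le_trans.
rewrite le_eqVlt; apply/orP; left; apply/eqP.
apply: eq_bigr => r Sr; apply: eq_bigr => j Sj; congr (abs2 (_ - _)).
apply: eq_bigr => q cq; rewrite /mrestr -(ca _ cq) -(cb _ cq) Sr Sj.
by rewrite (eq_rep cq).
Qed.

(* The blocks are disjoint and each entry of the block of a class is counted
   once per element of the class, whence the weights. *)
Lemma frob2_blocks (M X Y : mat R) : supp_in Sa X -> supp_in Sb Y ->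
  frob2 n m (msub M (mmul k X Y)) =
    \sum_(r < n) \sum_(j < m | ~~ [exists q : 'I_k, Sa r q && Sb q j]) abs2 (M r j)
    + \sum_(q < k) (#|ix k (c q)|%:R)^-1 * berr n m k (fun r => Sa r q) (Sb q) (c q) M X Y.
Proof.
move=> sX sY; pose E r j := abs2 (msub M (mmul k X Y) r j).
have berrE' q : berr n m k (fun r => Sa r q) (Sb q) (c q) M X Y
    = \sum_(r < n) \sum_(j < m) (if Sa r q && Sb q j then E r j else 0).
  rewrite /berr big_mkcond; apply: eq_bigr => r _; case: ifP => Sr; last first.
    by rewrite big1.
  rewrite big_mkcond; apply: eq_bigr => j _ /=; case: ifP => // Sj.
  rewrite /E /msub; congr (abs2 (_ - _)); rewrite /mmul big_mkcond /=.
  apply: eq_bigr => t _; case: ifPn => // ct.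
  have [->|/(suppN sX) h1] := eqVneq (X r t) 0; first by rewrite mul0r.
  have [->|/(suppN sY) h2] := eqVneq (Y t j) 0; first by rewrite mulr0.
  by rewrite (cof Sr h1 Sj h2) in ct.
under [X in _ + X]eq_bigr do rewrite berrE' mulr_sumr.
rewrite [X in _ + X]exchange_big -big_split /=; apply: eq_bigr => r _.
under [X in _ + X]eq_bigr do rewrite mulr_sumr.
rewrite [X in _ + X]exchange_big /= [X in X + _]big_mkcond -big_split /=; apply: eq_bigr => j _.
case: existsP => [[q0 /andP[h1 h2]]|no] /=; last first.
  rewrite big1 ?addr0 => [|q _]; last first.
    by case: ifP => h; [case: no; exists q|rewrite mulr0].
  rewrite /msub; have -> : mmul k X Y r j = 0; last by rewrite subr0.
  apply: big1 => t _.
  have [->|/(suppN sX) h1] := eqVneq (X r t) 0; first by rewrite mul0r.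
  have [->|/(suppN sY) h2] := eqVneq (Y t j) 0; first by rewrite mulr0.
  by case: no; exists t; rewrite h1.
rewrite add0r -/(E r j).
transitivity (\sum_(q in ix k (c q0)) (#|ix k (c q0)|%:R)^-1 * E r j).
  rewrite sumr_const -[RHS]mulr_natl mulrA mulfV ?mul1r // pnatr_eq0 -lt0n.
  by apply/card_gt0P; exists q0; rewrite inE; apply: crefl.
rewrite big_mkcond; apply: eq_bigr => q _; rewrite inE.
case: ifPn => cq; last first.
  case: ifP => [/andP[k1 k2]|]; last by rewrite mulr0.
  by rewrite (cof h1 k1 h2 k2) in cq.
rewrite -(ca _ cq) -(cb _ cq) h1 h2; congr (_^-1 * _); congr (_%:R).
apply: eq_card => t; rewrite !inE; apply/idP/idP; apply: ctrans => //; exact: csym.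
Qed.

(** In [frob2_blocks] the part outside the blocks depends on [M] only, so the block errors
    decide. *)
Lemma best_of_blocks (M X Y W V : mat R) :
  supp_in Sa X -> supp_in Sb Y -> supp_in Sa W -> supp_in Sb V ->
  (forall i, (i < k)%N -> berr n m k (fun r => Sa r i) (Sb i) (c i) M X Y
      <= berr n m k (fun r => Sa r i) (Sb i) (c i) M W V) ->
  frob2 n m (msub M (mmul k X Y)) <= frob2 n m (msub M (mmul k W V)).
Proof.
move=> sX sY sW sV le; rewrite !frob2_blocks // lerD2l; apply: ler_sum => q _.
by rewrite ler_wpM2l ?invr_ge0 ?ler0n // le.
Qed.

End Blocks.

(** * The subroutines of the algorithm *)

Section Subroutines.
Variables (R : rcfType) (beta : seq pattern).
Hypotheses (arch : is_arch beta) (chain : chainable_arch beta).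
Local Notation L := (size beta).
Local Notation D := (Dim beta).
Local Notation S := (Sup beta).
Local Notation cl := (Cls beta).
Local Notation H := (supp_sys_arch arch chain).
Implicit Types (X Y M : mat R).

Variables p s u : nat.
Hypotheses (ps : (0 < p <= s)%N) (su : (s < u <= L)%N).
Local Notation pl := (pint beta p s).
Local Notation pr := (pint beta s.+1 u).

Let sL : (0 < s < L)%N. Proof. lia. Qed.
Let sL' : (s <= L)%N. Proof. lia. Qed.
Let s1u : (0 < s.+1 <= u)%N. Proof. lia. Qed.
Let uL : (u <= L)%N. Proof. lia. Qed.

Let nrows_pl : nrows pl = D p.-1. Proof. exact: (pl_rows arch chain ps su). Qed.
Let ncols_pl : ncols pl = D s. Proof. exact: (pl_cols chain ps su). Qed.
Let ncols_pr : ncols pr = D u. Proof. exact: (pr_cols chain ps su). Qed.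

Let clL r t t' : cl s t t' -> S p s r t = S p s r t'.
Proof. by apply: (cl_l H) => //; case/andP: sL. Qed.
Let clR j t t' : cl s t t' -> S s.+1 u t j = S s.+1 u t' j.
Proof. by apply: (cl_r H) => //; case/andP: sL. Qed.
Let clrefl t : (t < D s)%N -> cl s t t. Proof. exact: (cl_refl H sL). Qed.
Let clsym t t' : cl s t t' -> cl s t' t. Proof. exact: (cl_sym H sL). Qed.
Let cltrans t t' t'' : cl s t t' -> cl s t' t'' -> cl s t t''.
Proof. exact: (cl_trans H sL). Qed.
Let cllt t t' : cl s t t' -> (t < D s)%N. Proof. exact: (cl_lt H sL). Qed.
Let clof r j t t' : S p s r t -> S p s r t' -> S s.+1 u t j -> S s.+1 u t' j -> cl s t t'.
Proof. exact: (cl_of H ps su). Qed.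
Let Sl_lt r t : S p s r t -> (r < D p.-1)%N && (t < D s)%N.
Proof. exact: (sp_lt H ps sL'). Qed.
Let Sr_lt t j : S s.+1 u t j -> (t < D s)%N && (j < D u)%N.
Proof. exact: (sp_lt H s1u uL). Qed.

Lemma RP_lt_Sup q r : (q < ncols pl)%N && RP pl pr q r = S p s r q.
Proof.
rewrite ncols_pl; case: (ltnP q (D s)) => qs /=.
  exact: (RPE arch chain ps su).
by apply/esym/negbTE/negP => /Sl_lt; rewrite (leq_gtF qs) andbF.
Qed.

Lemma CP_lt_Sup q j : (q < ncols pl)%N && CP pl pr q j = S s.+1 u q j.
Proof.
rewrite ncols_pl; case: (ltnP q (D s)) => qs /=.
  exact: (CPE arch chain ps su).
by apply/esym/negbTE/negP => /Sr_lt; rewrite (leq_gtF qs).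
Qed.

Lemma offblock0P X Y :
  offblock0 pl pr X Y <-> supp_in (S p s) X /\ supp_in (S s.+1 u) Y.
Proof.
split=> [[h1 h2]|[h1 h2]]; split=> i j h.
- by apply: h1; rewrite RP_lt_Sup.
- by apply: h2; rewrite CP_lt_Sup.
- by apply: h1; rewrite RP_lt_Sup in h.
- by apply: h2; rewrite CP_lt_Sup in h.
Qed.

Lemma blockerrE M X Y i : (i < D s)%N -> blockerr pl pr M X Y i =
  berr (D p.-1) (D u) (D s) (fun r => S p s r i) (S s.+1 u i) (cl s i) M X Y.
Proof.
move=> iS; rewrite /blockerr nrows_pl ncols_pl.
rewrite ncols_pr; apply: eq_big => [r|r _].
  exact: (RPE arch chain ps su).
apply: eq_big => [j|j _]; first exact: (CPE arch chain ps su).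
by congr (abs2 (_ - _)); apply: eq_bigl => q; apply: (inPE arch chain ps su).
Qed.

Lemma TwoFactor_best M X Y : TwoFactor pl pr M X Y -> best_fac D S p s u M X Y.
Proof.
case=> /offblock0P[sX sY]; rewrite ncols_pl => best.
split=> // W V sW sV.
apply: (best_of_blocks clL clR clrefl clsym cltrans clof) => // i iS.
by rewrite -!blockerrE //; apply: best.
Qed.

Lemma OrthoCol_spec X Y X' Y' : supp_in (S p s) X -> supp_in (S s.+1 u) Y ->
  OrthoCol pl pr X Y X' Y' ->
  [/\ supp_in (S p s) X', supp_in (S s.+1 u) Y' & exists T : mat R,
  [/\ supp_in (cl s) T,
      forall t t', cl s t t' -> mmul (D p.-1) (madj X') X' t t' = (t == t')%:R,
      X = mmul (D s) X' T & Y' = mmul (D s) T Y]].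
Proof.
move=> sX sY [/offblock0P[sX' sY'] blk]; split=> //.
apply: (ortho_block_transfer clL clR clrefl clsym cltrans cllt Sl_lt Sr_lt) => // i iS.
have [|Q [Rm [h1 _ h2 h3 h4]]] := blk i _; first by rewrite ncols_pl.
rewrite ncols_pl nrows_pl in h1 h2 h4.
have eR r : RP pl pr i r = S p s r i by apply: (RPE arch chain ps su).
have eC j : CP pl pr i j = S s.+1 u i j by apply: (CPE arch chain ps su).
have eP q : inP pl pr i q = cl s i q by apply: (inPE arch chain ps su).
exists Q, Rm; split.
- move=> a b aS bS ca cb; rewrite -(h1 a b) ?eP //; apply: eq_bigl => r; exact: esym.
- move=> r q Sr cq; rewrite h2 ?eR ?eP //; exact: eq_bigl.
- by move=> r q Sr cq; rewrite h3 ?eR ?eP.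
- move=> q j cq Sj; rewrite h4 ?eC ?eP //; exact: eq_bigl.
Qed.

(** Column orthogonalization of the transposed pair: left and right supports change roles, the
    classes stay. *)
Lemma OrthoRow_spec X Y X' Y' : supp_in (S p s) X -> supp_in (S s.+1 u) Y ->
  OrthoRow pl pr X Y X' Y' ->
  [/\ supp_in (S p s) X', supp_in (S s.+1 u) Y' & exists T : mat R,
  [/\ supp_in (cl s) T,
      forall t t', cl s t t' -> mmul (D u) (madj (mtr Y')) (mtr Y') t t' = (t == t')%:R,
      mtr Y = mmul (D s) (mtr Y') T & mtr X' = mmul (D s) T (mtr X)]].
Proof.
move=> sX sY [/offblock0P[sX' sY'] blk]; split=> //.
apply: (@ortho_block_transfer _ (D u) (D p.-1) (D s) (fun j q => S s.+1 u q j)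
  (fun q r => S p s r q) _ clR clL clrefl clsym cltrans cllt).
- by move=> j q /Sr_lt; rewrite andbC.
- by move=> q r /Sl_lt; rewrite andbC.
- by move=> i j; apply: sY.
- by move=> i j; apply: sX.
- by move=> i j; apply: sY'.
- by move=> i j; apply: sX'.
move=> i iS.
have [|Q [Rm [h1 _ h2 h3 h4]]] := blk i _; first by rewrite ncols_pl.
rewrite ncols_pl ?ncols_pr in h1 h2 h3.
have eR r : RP pl pr i r = S p s r i by apply: (RPE arch chain ps su).
have eC j : CP pl pr i j = S s.+1 u i j by apply: (CPE arch chain ps su).
have eP q : inP pl pr i q = cl s i q by apply: (inPE arch chain ps su).
exists Q, Rm; split.
- move=> a b aS bS ca cb; rewrite -(h1 a b) ?eP //; apply: eq_bigl => r; exact: esym.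
- move=> j q Sj cq; rewrite /mtr h2 ?eC ?eP //; exact: eq_bigl.
- by move=> j q Sj cq; rewrite /mtr h4 ?eC ?eP.
- move=> q r cq Sr; rewrite /mtr h3 ?eR ?eP //.
  by apply: eq_big => [t|t _]; [apply: eP|rewrite mulrC].
Qed.

Hypothesis nonred : ~ redundant_arch beta.

Lemma card_rows i : (i < D s)%N ->
  (#|[pred q : 'I_(D s) | cl s i q]| <= #|[pred r : 'I_(D p.-1) | S p s r i]|)%N.
Proof. by apply: card_Cls_rows => //; case/andP: sL. Qed.

Lemma card_cols i : (i < D s)%N ->
  (#|[pred q : 'I_(D s) | cl s i q]| <= #|[pred j : 'I_(D u) | S s.+1 u i j]|)%N.
Proof.
have h : (0 < s < u)%N by lia.
by apply: card_Cls_cols => //; apply: uL.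
Qed.

Lemma TwoFactor_exists M : exists X Y : mat R, TwoFactor pl pr M X Y.
Proof.
have [X [Y [sX sY best]]] :=
  best_block_exists (D u) clL clR clrefl clsym cltrans cllt M card_rows.
exists X, Y; split; first by apply/offblock0P.
move=> i; rewrite ncols_pl => iS W V; rewrite !blockerrE //.
exact: best.
Qed.

Lemma OrthoCol_exists X Y : exists X' Y' : mat R, OrthoCol pl pr X Y X' Y'.
Proof.
have [X' [Y' [sX sY blk]]] :=
  ortho_block_exists clL clR clrefl clsym cltrans cllt Sl_lt X Y card_rows.
exists X', Y'; split; first by apply/offblock0P.
move=> i; rewrite ncols_pl nrows_pl => iS.
have [Q [Rm [h1 hU h2 h3 h4]]] := blk i iS; exists Q, Rm.
have eR r : RP pl pr i r = S p s r i by apply: (RPE arch chain ps su).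
have eC j : CP pl pr i j = S s.+1 u i j by apply: (CPE arch chain ps su).
have eP q : inP pl pr i q = cl s i q by apply: (inPE arch chain ps su).
split.
- move=> a b aS bS ca cb; rewrite -(h1 a b) -?eP //; exact: eq_bigl.
- by move=> a b; rewrite !eP; apply: hU.
- by move=> r q; rewrite eR eP => Sr cq; rewrite h2 //; apply: eq_bigl => t; rewrite eP.
- by move=> r q; rewrite eR eP; apply: h3.
- by move=> q j; rewrite eC eP => cq Sj; rewrite h4 //; apply: eq_bigl => t; rewrite eP.
Qed.

Lemma OrthoRow_exists X Y : exists X' Y' : mat R, OrthoRow pl pr X Y X' Y'.
Proof.
have Sa_lt j q : S s.+1 u q j -> (j < D u)%N && (q < D s)%N by move/Sr_lt; rewrite andbC.
have [Y' [X' [sY sX blk]]] :=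
  @ortho_block_exists _ (D u) (D s) (fun j q => S s.+1 u q j) (fun q r => S p s r q) _
    clR clL clrefl clsym cltrans cllt Sa_lt (mtr Y) (mtr X) card_cols.
exists (mtr X'), (mtr Y'); split.
  by apply/offblock0P; split=> i j h; [apply: sX|apply: sY].
move=> i; rewrite ncols_pl ncols_pr => iS.
have [Q [Rm [h1 hU h2 h3 h4]]] := blk i iS; exists Q, Rm.
have eR r : RP pl pr i r = S p s r i by apply: (RPE arch chain ps su).
have eC j : CP pl pr i j = S s.+1 u i j by apply: (CPE arch chain ps su).
have eP q : inP pl pr i q = cl s i q by apply: (inPE arch chain ps su).
split.
- move=> a b aS bS ca cb; rewrite -(h1 a b) -?eP //; exact: eq_bigl.
- by move=> a b; rewrite !eP; apply: hU.
- move=> q j; rewrite eC eP => cq Sj; rewrite -[Y q j]/(mtr Y j q) h2 //.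
  by apply: eq_bigl => t; rewrite eP.
- move=> r q; rewrite eR eP => Sr cq; rewrite /mtr h4 //.
  by apply: eq_big => [t|t _]; rewrite ?eP // mulrC.
- by move=> q j; rewrite eC eP => cq Sj; rewrite /mtr h3.
Qed.

End Subroutines.

(** * States of the algorithm *)

Section States.
Variables (R : rcfType) (beta : seq pattern).
Hypotheses (arch : is_arch beta) (chain : chainable_arch beta).
Local Notation L := (size beta).
Local Notation D := (Dim beta).
Local Notation S := (Sup beta).
Local Notation cl := (Cls beta).
Local Notation nthe := (nth (e0 R)).
Implicit Types (st : seq (entry R)) (l h : nat -> nat).

Definition has_shape l h n st :=
  size st = n /\ forall k, (k < n)%N -> lo (nthe st k) = l k /\ hi (nthe st k) = h k.

Definition supp_st l h n st :=
  forall k, (k < n)%N -> supp_in (S (l k) (h k)) (emat (nthe st k)).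

Definition tiling l h n := forall k, (k < n)%N ->
  [/\ (0 < l k <= h k)%N, (h k <= L)%N & (k.+1 < n)%N -> l k.+1 = (h k).+1].

Lemma nth_set_nth2 st k (a b : entry R) : (k.+1 < size st)%N ->
  let st' := set_nth (e0 R) (set_nth (e0 R) st k a) k.+1 b in
  size st' = size st /\
  forall j, nthe st' j = if j == k.+1 then b else if j == k then a else nthe st j.
Proof.
move=> kst /=; split; first by rewrite !size_set_nth; lia.
by move=> j; rewrite !nth_set_nth /= nth_set_nth.
Qed.

Lemma ortho_stepP col k st st' l h n : ortho_step beta col k st st' ->
  has_shape l h n st -> exists X1 X2 : mat R,
  [/\ (k.+1 < n)%N,
      (if col then @OrthoCol R else @OrthoRow R) (pint beta (l k) (h k))
        (pint beta (l k.+1) (h k.+1)) (emat (nthe st k)) (emat (nthe st k.+1)) X1 X2,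
      has_shape l h n st' &
      forall j, emat (nthe st' j) = if j == k.+1 then X2 else if j == k then X1
                                    else emat (nthe st j)].
Proof.
case=> kst [X1 [X2 [o ->]]] [sz sh]; rewrite sz in kst.
have [l1 h1] := sh _ (ltnW kst); have [l2 h2] := sh _ kst.
exists X1, X2; rewrite -l1 -l2 -h1 -h2; split=> //.
  have [|s1 s2] := @nth_set_nth2 st k (Ent (lo (nthe st k)) (hi (nthe st k)) X1)
    (Ent (lo (nthe st k.+1)) (hi (nthe st k.+1)) X2); first by rewrite sz.
  split; first by rewrite s1.
  move=> j jn; rewrite s2; case: eqP => [->//|_]; case: eqP => [->//|_]; exact: sh.
move=> j; have [|_ ->] := @nth_set_nth2 st k (Ent (lo (nthe st k)) (hi (nthe st k)) X1)
    (Ent (lo (nthe st k.+1)) (hi (nthe st k.+1)) X2); first by rewrite sz.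
by case: eqP => // _; case: eqP.
Qed.

Lemma colsweep_shape k st st' l h n :
  colsweep beta k st st' -> has_shape l h n st -> has_shape l h n st'.
Proof.
move=> sw; elim: sw => // k' st0 st1 st2 _ IH o /IH sh.
by have [X1 [X2 []]] := ortho_stepP o sh.
Qed.

Lemma rowsweep_shape lw k st st' l h n :
  rowsweep beta lw k st st' -> has_shape l h n st -> has_shape l h n st'.
Proof.
move=> sw; elim: sw => // k' st0 st1 st2 _ o _ IH sh.
by apply: IH; have [X1 [X2 []]] := ortho_stepP o sh.
Qed.

(** Entries to the right of the split one move up by one place, hence the [k.-1]. *)
Lemma bstepP s st st'' l h n : bstep beta s st st'' -> has_shape l h n st ->
  exists jj st1 st2,
  [/\ (jj < n)%N && (l jj <= s < h jj)%N, colsweep beta jj st st1,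
      rowsweep beta jj n.-1 st1 st2, has_shape l h n st2 /\
      TwoFactor (pint beta (l jj) s) (pint beta s.+1 (h jj)) (emat (nthe st2 jj))
        (emat (nthe st'' jj)) (emat (nthe st'' jj.+1)) &
      [/\ has_shape (fun k => if (k <= jj)%N then l k else if k == jj.+1 then s.+1 else l k.-1)
            (fun k => if (k < jj)%N then h k else if k == jj then s else h k.-1) n.+1 st'',
          forall k, (k < jj)%N -> nthe st'' k = nthe st2 k &
          forall k, (jj.+1 < k)%N -> nthe st'' k = nthe st2 k.-1]].
Proof.
case=> jj [st1 [st2 [X1 [X2 [jst lh cs rs [tf e]]]]]] sh.
have sh2 := rowsweep_shape rs (colsweep_shape cs sh).
case: (sh) => sz shE; case: (sh2) => sz2 shE2; rewrite sz in jst rs.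
have [lj hj] := shE2 _ jst; have [lj0 hj0] := shE _ jst.
have szt : size (take jj st2) = jj by rewrite size_takel // sz2 ltnW.
have nlt k : (k < jj)%N -> nthe st'' k = nthe st2 k.
  by move=> kj; rewrite e nth_cat szt kj nth_take.
have ngt k : (jj.+1 < k)%N -> nthe st'' k = nthe st2 k.-1.
  move=> jk; rewrite e nth_cat szt; have -> : (k < jj)%N = false by lia.
  have -> : (k - jj = (k - jj.+2).+2)%N by lia.
  by rewrite /= nth_drop; congr (nthe _ _); lia.
have n0 : nthe st'' jj = Ent (lo (nthe st2 jj)) s X1.
  by rewrite e nth_cat szt ltnn subnn.
have n1 : nthe st'' jj.+1 = Ent s.+1 (hi (nthe st2 jj)) X2.
  by rewrite e nth_cat szt ltnNge leqnSn subSnn.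
exists jj, st1, st2; split=> //; first by rewrite jst -lj0 -hj0.
  by rewrite n0 n1 /= -lj -hj.
split=> //; split.
  by rewrite e !size_cat szt size_drop sz2 /=; lia.
move=> k kn; case: (ltngtP k jj) => kj.
- by rewrite nlt //; apply: shE2; lia.
- have [->|ne] := eqVneq k jj.+1; first by rewrite n1 /= hj.
  by rewrite ngt; [apply: shE2|]; lia.
- by rewrite kj n0 /= lj.
Qed.

Lemma shape_ext l h l' h' n st : has_shape l h n st ->
  (forall k, (k < n)%N -> l k = l' k /\ h k = h' k) -> has_shape l' h' n st.
Proof.
by case=> sz sh e; split=> // k kn; have [-> ->] := sh k kn; have [-> ->] := e k kn.
Qed.

Section Existence.
Hypothesis nonred : ~ redundant_arch beta.
Variables (l h : nat -> nat) (n : nat).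
Hypothesis til : tiling l h n.

Lemma ortho_step_exists col k st : (k.+1 < n)%N -> has_shape l h n st ->
  exists st', ortho_step beta col k st st'.
Proof.
move=> kn [sz sh]; have [l1 h1] := sh _ (ltnW kn); have [l2 h2] := sh _ kn.
have [lh hL /(_ kn) e] := til (ltnW kn); have [lh' hL' _] := til kn.
have hu : (h k < h k.+1 <= L)%N by lia.
rewrite /ortho_step sz l1 h1 l2 h2 e.
have [X1 [X2 o]] : exists X1 X2 : mat R, (if col then @OrthoCol R else @OrthoRow R)
    (pint beta (l k) (h k)) (pint beta (h k).+1 (h k.+1))
    (emat (nthe st k)) (emat (nthe st k.+1)) X1 X2.
  case: col; [exact: OrthoCol_exists|exact: OrthoRow_exists].
by eexists; split=> //; exists X1, X2; split.
Qed.

Lemma colsweep_exists k st : (k < n)%N -> has_shape l h n st -> exists st', colsweep beta k st st'.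
Proof.
move=> + sh; elim: k => [|k IH] kn; first by exists st; apply: cs0.
have [st1 cs] := IH (ltnW kn).
have [st2 o] := ortho_step_exists true kn (colsweep_shape cs sh).
by exists st2; apply: csS o.
Qed.

Lemma rowsweep_exists lw k st : (lw <= k < n)%N -> has_shape l h n st ->
  exists st', rowsweep beta lw k st st'.
Proof.
elim: k st => [|k IH] st lk sh.
  by have -> : lw = 0%N; [lia|exists st; apply: rs0].
have [->|ne] := eqVneq lw k.+1; first by exists st; apply: rs0.
have [|st1 o] := @ortho_step_exists false k st _ sh; first lia.
have [X1 [X2 [_ _ sh1 _]]] := ortho_stepP o sh.
have [|st2 rs] := IH st1 _ sh1; first lia.
by exists st2; apply: rsS o rs; lia.
Qed.

Lemma bstep_exists jj s st : (jj < n)%N -> (l jj <= s < h jj)%N -> has_shape l h n st ->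
  exists st', bstep beta s st st'.
Proof.
move=> jn ls sh; have [st1 cs] := colsweep_exists jn sh.
have sh1 := colsweep_shape cs sh.
have [|st2 rs] := @rowsweep_exists jj n.-1 st1 _ sh1; first lia.
have sh2 := rowsweep_shape rs sh1.
have [lh hL _] := til jn.
have [h1 h2] : (0 < l jj <= s)%N /\ (s < h jj <= L)%N by lia.
have [X1 [X2 tf]] := TwoFactor_exists arch chain h1 h2 nonred (emat (nthe st2 jj)).
case: (sh) => sz shE; case: (sh2) => _ shE2.
have [lj hj] := shE2 _ jn; have [lj0 hj0] := shE _ jn.
eexists; exists jj, st1, st2, X1, X2; split; rewrite ?sz ?lj0 ?hj0 //=.
by rewrite lj hj; split.
Qed.

End Existence.

(** After [J] steps of the increasing order the intervals are [[1,1], ..., [J,J], [J+1,L]], with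
    places counted from 0. *)
Definition lo_iota k := k.+1.
Definition hi_iota J k := if (k < J)%N then k.+1 else L.

Lemma tiling_iota J : (J < L)%N -> tiling lo_iota (hi_iota J) J.+1.
Proof. by move=> JL k kJ; rewrite /lo_iota /hi_iota; case: (ltnP k J) => ?; split=> [||?]; lia. Qed.

(** After [J] steps of the reverse order the intervals are [[1,L-J], [L-J+1,L-J+1], ..., [L,L]]. *)
Definition lo_rev J k := if k is 0%N then 1%N else (L - J + k)%N.
Definition hi_rev J k := (L - J + k)%N.

Lemma tiling_rev J : (J < L)%N -> tiling (lo_rev J) (hi_rev J) J.+1.
Proof. by move=> JL [|k] kJ; rewrite /lo_rev /hi_rev; split=> [||?]; lia. Qed.

Definition mats st k : mat R := emat (nthe st k).
(** The state is read from the right and transposed. Beyond [J] the truncated [J - k] would fall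
    back on entry 0, which a sweep may change; the zero matrix keeps those places fixed, as the last
    clause of [aortho] demands. *)
Definition rmats J st k : mat R :=
  if (k <= J)%N then mtr (emat (nthe st (J - k)%N)) else mat0 R.
Local Notation D' := (fun x => D (L - x)%N).
Local Notation S' := (fun p q i j => S (L.+1 - q)%N (L.+1 - p)%N j i).
Local Notation cl' := (fun s => cl (L - s)%N).

Lemma colsweep_asweep J k st st1 : (J < L)%N -> colsweep beta k st st1 -> (k <= J)%N ->
  has_shape lo_iota (hi_iota J) J.+1 st -> supp_st lo_iota (hi_iota J) J.+1 st ->
  asweep D S cl 0 k (mats st) (mats st1) /\ supp_st lo_iota (hi_iota J) J.+1 st1.
Proof.
move=> JL sw; elim: sw => [st0 _ _ ss|k' st0 st2 st3 cs IH o kJ sh ss].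
  by split=> //; apply: asweep0.
have {IH}[sw ss2] := IH (ltnW kJ) sh ss.
have sh2 := colsweep_shape cs sh.
have [X1 [X2 [kn oc sh3 e]]] := ortho_stepP o sh2.
have eh : hi_iota J k' = k'.+1 by rewrite /hi_iota kJ.
have s1 := ss2 k' (ltnW kn); have s2 := ss2 k'.+1 kn; rewrite eh /= in s1 oc.
have [hp hu] : (0 < k'.+1 <= k'.+1)%N /\ (k'.+1 < hi_iota J k'.+1 <= L)%N.
  by rewrite /hi_iota; case: (ltnP k'.+1 J) => ?; lia.
have [sX1 sX2 [T [sT oX eX eY]]] := OrthoCol_spec arch chain hp hu s1 s2 oc.
have ne1 : (k' == k'.+1) = false by lia.
split.
  apply: asweepS sw _; exists T; rewrite /mats !e !eqxx ne1; split=> //.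
  by move=> j /negPf n1 /negPf n2; rewrite e n1 n2.
move=> j jJ; rewrite e; case: eqP => [->//|_]; case: eqP => [->|_]; last exact: ss2.
by rewrite eh.
Qed.

(** The pair [(k-1, k)] becomes [(J-k, J-k+1)] in the mirror, so a row sweep coming down from [k] is
    a column sweep going up from [J-k]. *)
Lemma rowsweep_asweep J k st st1 : (J < L)%N -> rowsweep beta 0 k st st1 -> (k <= J)%N ->
  has_shape (lo_rev J) (hi_rev J) J.+1 st -> supp_st (lo_rev J) (hi_rev J) J.+1 st ->
  asweep D' S' cl' (J - k) J (rmats J st) (rmats J st1) /\ supp_st (lo_rev J) (hi_rev J) J.+1 st1.
Proof.
move=> JL sw; elim: sw => [st0 _ _ ss|k' st0 st2 st3 _ o rs IH kJ sh ss].
  by rewrite subn0; split=> //; apply: asweep0.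
have [X1 [X2 [kn oc sh2 e]]] := ortho_stepP o sh.
have s1 := ss k' (ltnW kn); have s2 := ss k'.+1 kn.
have el : lo_rev J k'.+1 = (hi_rev J k').+1 by rewrite /lo_rev /hi_rev; lia.
rewrite el in s2 oc.
have [hp hu] : (0 < lo_rev J k' <= hi_rev J k')%N /\ (hi_rev J k' < hi_rev J k'.+1 <= L)%N.
  by rewrite /lo_rev /hi_rev; case: (k') kn => [|?] ?; lia.
have [sX1 sX2 [T [sT oX eX eY]]] := OrthoRow_spec arch chain hp hu s1 s2 oc.
have ss2 : supp_st (lo_rev J) (hi_rev J) J.+1 st2.
  move=> j jJ; rewrite e; case: eqP => [->|_]; first by rewrite el.
  by case: eqP => [->//|_]; apply: ss.
have {IH}[sw ss3] := IH (ltnW kJ) sh2 ss2; split=> //.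
have ek : (J - k' = (J - k'.+1).+1)%N by lia.
rewrite ek in sw; apply: asweep_cons sw.
have i1 : (J - (J - k'.+1) = k'.+1)%N by lia.
have i2 : (J - (J - k'.+1).+1 = k')%N by lia.
have j1 : (L - (J - k'.+1).+1 = hi_rev J k')%N by rewrite /hi_rev; lia.
have j2 : (L - (J - k'.+1) = hi_rev J k'.+1)%N by rewrite /hi_rev; lia.
have j3 : (hi_rev J k').+1 = hi_rev J k'.+1 by rewrite /hi_rev; lia.
have ne1 : (k' == k'.+1) = false by lia.
have k1 : (J - k'.+1 <= J)%N by lia.
have k2 : (J - k'.+1 < J)%N by lia.
exists T; rewrite /rmats k1 k2 i1 i2 !e !eqxx ne1 ?subSS j1 j2; split=> //.
- by move=> i j nS; apply: sX2; move: nS; rewrite /= j3.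
move=> j n1 n2; case: leqP => // jJ; rewrite e.
have -> : (J - j == k'.+1)%N = false by lia.
by have -> : (J - j == k')%N = false by lia.
Qed.

End States.

(** * The two orders *)

Section Runs.
Variables (R : realType) (beta : seq pattern) (A : mat R).
Hypotheses (arch : is_arch beta) (chain : chainable_arch beta).
Local Notation L := (size beta).
Local Notation D := (Dim beta).
Local Notation S := (Sup beta).
Local Notation cl := (Cls beta).
Local Notation nthe := (nth (e0 R)).
Local Notation D' := (fun x => D (L - x)%N).
Local Notation S' := (fun p q i j => S (L.+1 - q)%N (L.+1 - p)%N j i).
Local Notation cl' := (fun s => cl (L - s)%N).
Implicit Types (st : seq (entry R)).

Lemma Dim_ncols l : (0 < l)%N -> D l = ncols (pat_at beta l).
Proof. by case: l. Qed.

(** For [x > 0] its square root is a lower bound of the norms, hence of their infimum; the zero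
    factors show that the set of norms is nonempty. *)
Lemma Ebeta_ge k x : (0 < k < L)%N ->
  (forall W V : mat R, supp_in (S 1 k) W -> supp_in (S k.+1 L) V ->
     x <= frob2 (D 0) (D L) (msub A (mmul (D k) W V))) -> x <= Ebeta beta A k ^+ 2.
Proof.
move=> kL lb; have [x0|x0] := lerP x 0; first by apply: le_trans x0 _; apply: sqr_ge0.
have ek : ncols (pint beta 1 k) = D k by apply: ncols_pint => //; lia.
have le : Num.sqrt x <= Ebeta beta A k.
  apply: lb_le_inf.
    by eexists; exists (mat0 R), (mat0 R); split.
  move=> y [X [Y [sX sY ->]]]; rewrite ler_sqrt ?frob2_ge0 // ek -Dim_ncols; last lia.
  exact: lb.
rewrite -(sqr_sqrtr (ltW x0)).
by apply: lerXn2r => //; rewrite nnegrE ?(le_trans _ le) ?sqrtr_ge0.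
Qed.

Local Notation e := (fun k => Ebeta beta A k ^+ 2).
Local Notation e' := (fun k => Ebeta beta A (L - k) ^+ 2).

Lemma Ebeta_ge_mirror k x : (0 < k < L)%N ->
  (forall W V : mat R, supp_in (S' 1%N k) W -> supp_in (S' k.+1 L) V ->
     x <= frob2 (D' 0%N) (D' L) (msub (mtr A) (mmul (D' k) W V))) -> x <= e' k.
Proof.
move=> kL lb; apply: Ebeta_ge => [|W V sW sV]; first lia.
have -> : frob2 (D 0) (D L) (msub A (mmul (D (L - k)%N) W V))
    = frob2 (D' 0%N) (D' L) (msub (mtr A) (mmul (D' k) (mtr V) (mtr W))).
  by rewrite -mtr_mmul subn0 subnn -[RHS]frob2_mtr.
apply: lb => i j nS.
  by apply: sV; move: nS; rewrite subSS subn0; have -> : (L.+1 - k = (L - k).+1)%N by lia.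
by apply: sW; move: nS; rewrite subSS; have -> : (L.+1 - L = 1)%N by lia.
Qed.

Lemma best_fac_mirror p s u (M X Y : mat R) : (0 < p <= s)%N -> (s < u <= L)%N ->
  best_fac D S p s u M X Y ->
  best_fac D' S' (L.+1 - u) (L - s) (L.+1 - p) (mtr M) (mtr Y) (mtr X).
Proof.
move=> ps su [sX sY best].
have e1 : (L.+1 - (L - s) = s.+1)%N by lia.
have e2 : (L.+1 - (L.+1 - u) = u)%N by lia.
have e3 : (L.+1 - (L.+1 - p) = p)%N by lia.
have e4 : (L.+1 - (L - s).+1 = s)%N by lia.
have e5 : (L - (L.+1 - u).-1 = u)%N by lia.
have e6 : (L - (L.+1 - p) = p.-1)%N by lia.
have e7 : (L - (L - s) = s)%N by lia.
rewrite /best_fac e1 e2 e3 e4 e5 e6 e7; split.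
- by move=> i j; apply: sY.
- by move=> i j; apply: sX.
have E W V : frob2 (D u) (D p.-1) (msub (mtr M) (mmul (D s) W V))
    = frob2 (D p.-1) (D u) (msub M (mmul (D s) (mtr V) (mtr W))).
  by rewrite -(mtr_mmul (D s) W V) -[LHS]frob2_mtr.
move=> W V sW sV; rewrite !E; exact: (best _ _ (fun i j => sV j i) (fun i j => sW j i)).
Qed.

Lemma colsweep0 st st' : colsweep beta 0 st st' -> st' = st.
Proof. by move=> sw; inversion sw. Qed.

Lemma rowsweep_refl k st st' : rowsweep beta k k st st' -> st' = st.
Proof.
move=> sw; inversion sw => //; subst; lia.
Qed.

Lemma bfly0 sigma st : bfly beta sigma A 0 st -> st = [:: Ent 1 L A].
Proof. by move=> b; inversion b. Qed.

Local Notation invI := (run_inv L D S cl A e).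
Local Notation invR := (run_inv L D' S' cl' (mtr A) e').

(** Before the first cut only the shape is available; the invariant starts at [J = 1]. *)
Lemma bfly_iota J st : (1 < L)%N -> bfly beta (iota 1 L.-1) A J st -> (J < L)%N ->
  has_shape lo_iota (hi_iota beta J) J.+1 st /\ ((0 < J)%N -> invI J (mats st)).
Proof.
move=> L1; elim: J st => [|J IH] st b JL.
  by rewrite (bfly0 b); split=> //; split=> // -[].
inversion b as [|J0 st0 st0' b0 bs]; subst.
have {IH}[sh inv] := IH _ b0 (ltnW JL).
have es : nth 0%N (iota 1 L.-1) J = J.+1 by rewrite nth_iota ?add1n //; lia.
rewrite es in bs.
have [jj [st1 [st2 [/andP[jJ lh] cs rs [sh2 tf] [sh' nlt ngt]]]]] := bstepP bs sh.
(* The cut [J+1] falls in the long interval, which is the last one; the row sweep is therefore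
   empty. *)
have ej : jj = J by move: lh; rewrite /lo_iota /hi_iota; case: (ltnP jj J); lia.
subst jj; have eh : hi_iota beta J J = L by rewrite /hi_iota ltnn.
rewrite eh {1}/lo_iota in tf; rewrite (rowsweep_refl rs) in tf nlt ngt.
have shJ : has_shape lo_iota (hi_iota beta J.+1) J.+2 st.
  apply: shape_ext sh' _ => k kJ; rewrite /lo_iota /hi_iota; split.
    by case: leqP => // ?; case: eqP => [->//|?]; lia.
  case: (ltngtP k J) => kJ'.
  + by have -> : (k < J.+1)%N by lia.
  + have -> : (k < J.+1)%N = false by lia.
    by have -> : (k.-1 < J)%N = false by lia.
  + by rewrite kJ' ltnSn.
split=> // _.
have [h1 h2] : (0 < J.+1 <= J.+1)%N /\ (J.+1 < L <= L)%N by lia.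
have best := TwoFactor_best arch chain h1 h2 tf.
have [J0|J0] := posnP J.
  subst J; rewrite (colsweep0 cs) (bfly0 b0) in best.
  by apply: (run_inv1 (supp_sys_arch arch chain)) => //; apply: Ebeta_ge.
have := inv J0; case=> [sX sXJ _ _ _].
have ss : supp_st beta lo_iota (hi_iota beta J) J.+1 st0.
  move=> k kJ; rewrite /hi_iota /lo_iota; case: (ltnP k J) => [/sX//|Jk].
  by have -> : k = J by lia.
have [sw _] := colsweep_asweep arch chain (ltnW JL) cs (leqnn J) sh ss.
apply: (run_invS (supp_sys_arch arch chain)) (inv J0) _ => //; first exact: Ebeta_ge.
by exists (mats st1); split=> // j jJ'; rewrite /mats nlt.
Qed.

Lemma bfly_rev_iota J st : (1 < L)%N -> bfly beta (rev (iota 1 L.-1)) A J st -> (J < L)%N ->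
  has_shape (lo_rev beta J) (hi_rev beta J) J.+1 st /\ ((0 < J)%N -> invR J (rmats J st)).
Proof.
move=> L1; elim: J st => [|J IH] st b JL.
  rewrite (bfly0 b); split=> //; split=> // -[|//] _.
  by rewrite /hi_rev /= subn0 addn0.
inversion b as [|J0 st0 st0' b0 bs]; subst.
have {IH}[sh inv] := IH _ b0 (ltnW JL).
have es : nth 0%N (rev (iota 1 L.-1)) J = (L - J.+1)%N.
  by rewrite nth_rev size_iota ?nth_iota ?add1n //; lia.
rewrite es in bs.
have [jj [st1 [st2 [/andP[jJ lh] cs rs [sh2 tf] [sh' nlt ngt]]]]] := bstepP bs sh.
(* Here the long interval is the first one, so the column sweep is empty. *)
have ej : jj = 0%N by move: lh; rewrite /lo_rev /hi_rev; case: (jj) => // ?; lia.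
subst jj; rewrite (colsweep0 cs) /= in rs.
have eh : hi_rev beta J 0 = (L - J)%N by rewrite /hi_rev addn0.
rewrite eh /= in tf.
have shJ : has_shape (lo_rev beta J.+1) (hi_rev beta J.+1) J.+2 st.
  apply: shape_ext sh' _ => -[|[|k]] kJ; rewrite /lo_rev /hi_rev /=; split; lia.
split=> // _.
have [h1 h2] : (0 < 1 <= L - J.+1)%N /\ (L - J.+1 < L - J <= L)%N by lia.
have := best_fac_mirror h1 h2 (TwoFactor_best arch chain h1 h2 tf).
have -> : (L.+1 - (L - J) = J.+1)%N by lia.
have -> : (L - (L - J.+1) = J.+1)%N by lia.
have -> : (L.+1 - 1 = L)%N by lia.
have -> : mtr (emat (nthe st 1)) = rmats J.+1 st J by rewrite /rmats leqnSn subSnn.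
have -> : mtr (emat (nthe st 0)) = rmats J.+1 st J.+1 by rewrite /rmats leqnn subnn.
move=> best.
have H' := supp_sys_mirror (supp_sys_arch arch chain).
have [J0|J0] := posnP J.
  subst J; rewrite (rowsweep_refl rs) (bfly0 b0) in best.
  by apply: (run_inv1 H') => //; apply: Ebeta_ge_mirror.
have := inv J0; case=> [sX sXJ _ _ _].
have ss : supp_st beta (lo_rev beta J) (hi_rev beta J) J.+1 st0.
  move=> [|k] kJ i j nS.
    have := sXJ j i; rewrite /rmats leqnn subnn; apply; move: nS.
    by rewrite /lo_rev /hi_rev addn0 subSS; have -> : (L.+1 - L = 1)%N by lia.
  have lt : (J - k.+1 < J)%N by lia.
  have := sX _ lt j i; rewrite /rmats (ltnW lt).
  have -> : (J - (J - k.+1) = k.+1)%N by lia.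
  apply; move: nS; rewrite /lo_rev /hi_rev.
  by have -> : (L.+1 - (J - k.+1).+1 = L - J + k.+1)%N by lia.
have [sw _] := rowsweep_asweep arch chain (ltnW JL) rs (leqnn J) sh ss.
rewrite subnn in sw.
apply: (run_invS H') (inv J0) _ => //; first exact: Ebeta_ge_mirror.
exists (rmats J st2); split=> //.
  move=> j jJ'; rewrite /rmats (ltnW jJ') (leqW (ltnW jJ')) ngt; last lia.
  by congr (mtr (emat (nthe _ _))); lia.
by move: best; rewrite {3}/rmats leqnn subnn.
Qed.

(** [chainprod] nests to the right, [pprod] to the left; peeling off one factor at a time leads from
    one to the other. *)
Lemma chainprodS st j : (j.+1 < L)%N ->
  chainprod (drop j beta) [seq mats st k | k <- iota j (L - j)] =
  mmul (D j.+1) (mats st j)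
    (chainprod (drop j.+1 beta) [seq mats st k | k <- iota j.+1 (L - j.+1)]).
Proof.
move=> jL; have -> : (L - j = (L - j.+1).+1)%N by lia.
rewrite (drop_nth pat0) ?(ltnW jL) //=.
(* [chainprod] multiplies only once it sees a further factor, so the next entry is exposed too. *)
have -> : (L - j.+1 = (L - j.+2).+1)%N by lia.
by rewrite (drop_nth pat0 jL).
Qed.

Lemma chainprod_last st : (0 < L)%N ->
  chainprod (drop L.-1 beta) [seq mats st k | k <- iota L.-1 (L - L.-1)] = mats st L.-1.
Proof.
move=> L0; have -> : (L - L.-1 = 1)%N by lia.
rewrite (drop_nth pat0) ?ltn_predL // prednK // drop_size //.
Qed.

End Runs.

Theorem theorem7p3 (R : realType) (beta : seq pattern) (sigma : seq nat)
    (A : mat R) :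
  (2 <= size beta)%N ->
  is_arch beta -> chainable_arch beta -> ~ redundant_arch beta ->
  (sigma = iota 1 (size beta).-1 \/ sigma = rev (iota 1 (size beta).-1)) ->
  (exists st, bfly beta sigma A (size beta).-1 st) /\
  (forall st, bfly beta sigma A (size beta).-1 st ->
     (forall l, (1 <= l <= size beta)%N -> is_factor (pat_at beta l) (outX st l)) /\
     frob (nrows (pat_at beta 1)) (ncols (pat_at beta (size beta)))
          (msub A (chainprod beta [seq outX st l | l <- iota 1 (size beta)])) ^+ 2
     <= \sum_(1 <= k < size beta) Ebeta beta A k ^+ 2).
Proof.
move=> L2 arch chain nonred sg.
have L0 : (0 < (size beta).-1 < size beta)%N by lia.
have [L1 LL] := andP L0.
split.
  (* Every reached state has the known shape, which locates the interval of the next cut and makes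
     the next step possible. *)
  suff ex J : (J < size beta)%N -> exists st, bfly beta sigma A J st by apply: ex.
  elim: J => [_|J IH JL]; first by eexists; apply: bf0.
  have [st b] := IH (ltnW JL).
  suff [st' bs] : exists st', bstep beta (nth 0%N sigma J) st st'.
    by exists st'; apply: bfS bs.
  case: sg => es; rewrite es in b *.
    have [sh _] := bfly_iota arch chain L2 b (ltnW JL).
    apply: (bstep_exists arch chain nonred (tiling_iota (ltnW JL)) (ltnSn J)) sh.
    by rewrite nth_iota /hi_iota /lo_iota ?ltnn; lia.
  have [sh _] := bfly_rev_iota arch chain L2 b (ltnW JL).
  apply: (bstep_exists arch chain nonred (tiling_rev (ltnW JL)) (ltn0Sn J)) sh.
  by rewrite nth_rev size_iota ?nth_iota /hi_rev /lo_rev; lia.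
move=> st b.
have eO : [seq outX st l | l <- iota 1 (size beta)] = [seq mats st k | k <- iota 0 (size beta)].
  by rewrite (iotaDl 1 0) -map_comp; apply: eq_map.
rewrite eO frob_sqr -Dim_ncols -/(Dim beta 0); last lia.
have c0 : chainprod (drop 0 beta) [seq mats st k | k <- iota 0 (size beta - 0)]
   = chainprod beta [seq mats st k | k <- iota 0 (size beta)] by rewrite drop0 subn0.
case: sg => es; rewrite es in b.
  have [sh /(_ L1)[sX sXJ _ _ bnd]] := bfly_iota arch chain L2 b LL.
  rewrite prednK ?(ltnW L2) // in sXJ bnd; split.
    move=> l lL; have [le|ne] := eqVneq l (size beta).
      by rewrite le -pintxx.
    have := sX l.-1; rewrite prednK -?pintxx; first (by apply; lia); lia.
  apply: le_trans bnd; rewrite le_eqVlt; apply/orP; left; apply/eqP.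
  congr (frob2 _ _ (msub _ _)); rewrite -c0.
  suff E j : (j.+1 < size beta)%N ->
     chainprod (drop 0 beta) [seq mats st k | k <- iota 0 (size beta - 0)]
     = mmul (Dim beta j.+1) (pprod (Dim beta) j.+1 (mats st))
        (chainprod (drop j.+1 beta) [seq mats st k | k <- iota j.+1 (size beta - j.+1)]).
    have := E (size beta).-2; rewrite prednK; last lia.
    by rewrite chainprod_last; [apply|]; lia.
  elim: j => [|j IH] jL; rewrite ?IH 1?ltnW //.
    rewrite chainprodS //=; congr mmul; apply/esym.
    apply: (mmul_idl _ (sX 0%N _)) => // i j h.
    by apply: (sp_ltl (supp_sys_arch arch chain) _ _ h); lia.
  by rewrite chainprodS // -mmulA.
have [sh /(_ L1)[sX sXJ _ _ bnd]] := bfly_rev_iota arch chain L2 b LL.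
set rm := rmats _ _ in sX sXJ bnd.
have sR k : (k < size beta)%N ->
    supp_in (fun i j => Sup beta (size beta - k) (size beta - k) j i) (rm k).
  (* The invariant lists the last mirrored factor apart; it is the one of the first pattern. *)
  move=> kL; have [ek|ne] := eqVneq k (size beta).-1; last by apply: sX; lia.
  have -> : (size beta - k = 1)%N by lia.
  move: sXJ; rewrite ek prednK; last lia.
  by have -> : ((size beta).+1 - size beta = 1)%N by lia.
have rmE k : (k < size beta)%N -> rm ((size beta).-1 - k)%N = mtr (mats st k).
  move=> kL; rewrite /rm /rmats leq_subr /mats.
  by congr (mtr (emat (nth _ _ _))); lia.
split.
  move=> l lL i j nS.
  have lt : (l.-1 < size beta)%N by lia.
  have lt' : ((size beta).-1 - l.-1 < size beta)%N by lia.
  have := sR _ lt' j i; rewrite (rmE _ lt); apply.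
  have -> : (size beta - ((size beta).-1 - l.-1) = l)%N by lia.
  by rewrite /Sup pintxx.
(* Transposition reverses products: the last [j+1] factors become the mirrored prefix of [j+1]
   factors. *)
have E j : (j < size beta)%N ->
    mtr (chainprod (drop ((size beta).-1 - j) beta)
      [seq mats st k | k <- iota ((size beta).-1 - j) (size beta - ((size beta).-1 - j))])
    = pprod (fun x => Dim beta (size beta - x)%N) j.+1 rm.
  elim: j => [_|j IH jL].
    rewrite subn0 chainprod_last; last lia.
    rewrite /= (mmul_idl (S := fun i j => Sup beta (size beta - 0) (size beta - 0) j i));
      [|move=> i j h|by apply: sR; lia].
      by rewrite -rmE // subnn.
    by rewrite subn0 in h *; apply: (sp_ltr (supp_sys_arch arch chain) _ _ h); lia.
  have ei : ((size beta).-1 - j = ((size beta).-1 - j.+1).+1)%N by lia.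
  rewrite chainprodS; last lia.
  rewrite mtr_mmul -ei IH; last lia.
  rewrite [RHS]/=; have -> : (size beta - j.+1 = (size beta).-1 - j)%N by lia.
  congr mmul; rewrite -rmE; last lia.
  by congr rm; lia.
rewrite -[leLHS]frob2_mtr.
have := E (size beta).-1; rewrite subnn drop0 subn0 => E0.
(* The mirrored errors are [Ebeta] at [L-k]; reversing the summation restores the order. *)
rewrite big_nat_rev /=; move: bnd; rewrite subn0 prednK; last lia.
rewrite subnn => bnd; apply: le_trans (le_trans _ bnd) _.
all: rewrite le_eqVlt; apply/orP; left; apply/eqP.
  congr (frob2 _ _ _); rewrite -[mtr (msub _ _)]/(msub (mtr A) (mtr _)) E0 //.
by rewrite !big_nat; apply: eq_bigr => k kL; congr (Ebeta _ _ _ ^+ 2); lia.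
Qed.
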